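(* For $\beta\in(0,1)$ let $$\gamma(\beta):=\inf\{\gamma_0<0:\ \text{there exists } u\in\Pi' \text{ with } u\in\Pi^*(\beta,\gamma)\text{ for all }\gamma\in[\gamma_0,0]\}.$$ (a) For every $\beta\in(0,1)$ it holds that $\gamma(\beta)\in[-\infty,0)$, and there exists $u_\beta\in\Pi'$ such that $u_\beta\in\Pi^*(\beta,\gamma)$ for every $\gamma\in[\gamma(\beta),0]$. In particular, if $\gamma(\beta)>-\infty$, the maximal interval (to the left of zero) on which a single stationary policy is optimal is closed at its left endpoint. (b) The mapping $\beta\mapsto\gamma(\beta)$ is lower semicontinuous on $(0,1)$. The analogous statements hold to the right of zero: with $$\gamma_+(\beta):=\sup\{\gamma_0>0:\ \text{there exists } u\in\Pi' \text{ with } u\in\Pi^*(\beta,\gamma)\text{ for all }\gamma\in[0,\gamma_0]\},$$ for every $\beta\in(0,1)$ one has $\gamma_+(\beta)\in(0,+\infty]$ and there exists $u\in\Pi'$ such that $u\in\Pi^*(\beta,\gamma)$ for every $\gamma\in[0,\gamma_+(\beta)]$, and the mapping $\beta\mapsto\gamma_+(\beta)$ is upper semicontinuous on $(0,1)$.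
   Context: Conventions: $[-\infty,0]:=(-\infty,0]$ and $[0,+\infty]:=[0,+\infty)$ when these denote ranges of the parameter $\gamma$; semicontinuity is understood for extended-real-valued functions. Setting (finite discounted risk-sensitive MDP). $E=\{x_1,\dots,x_k\}$ is a finite state space and $U=\{\tilde u_1,\dots,\tilde u_l\}$ a finite action space (both nonempty); every action is available in every state. For $a\in U$, $P^a=[p_a(x_i,x_j)]_{i,j=1}^k$ is a transition probability matrix. $c\colon E\times U\to\mathbb{R}$ is a fixed running reward. $(X_n)_{n\ge 0}$ is the canonical state process. A policy is a sequence $\pi=(a_n)_{n\ge0}$, where $a_n$ is a $U$-valued function of $(X_0,\dots,X_n)$; $\Pi$ is the set of all policies. $\mathbb{E}_x^\pi$ is the expectation under the law of the process with $X_0=x$ and $\mathbb{P}(X_{n+1}=y\mid X_0,\dots,X_n)=p_{a_n}(X_n,y)$. $\Pi''\subset\Pi$ is the set of Markov policies, identified with sequences $(u_n)_{n\ge0}$, $u_n\colon E\to U$, via $a_n=u_n(X_n)$. $\Pi'\subset\Pi''$ is the set of stationary Markov policies, identified with functions $u\colon E\to U$, via $a_n=u(X_n)$ for all $n$. For $\gamma\in\mathbb{R}$, $\beta\in(0,1)$, $x\in E$, $\pi=(a_i)_{i\ge 0}\in\Pi$, put $$J_\gamma(x,\pi;\beta):=\begin{cases}\frac1\gamma\ln\mathbb{E}_x^\pi\big[e^{\gamma\sum_{i=0}^\infty\beta^i c(X_i,a_i)}\big],&\gamma\ne0,\\ \mathbb{E}_x^\pi\big[\sum_{i=0}^\infty\beta^i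 c(X_i,a_i)\big],&\gamma=0.\end{cases}$$ $\Pi^*(\beta,\gamma)$ is the set of Markov policies $\pi\in\Pi''$ that are optimal for every starting point, i.e. $J_\gamma(x,\pi;\beta)=\sup_{\pi'\in\Pi}J_\gamma(x,\pi';\beta)$ for all $x\in E$. *)

(* Defs.v *)
From HB Require Import structures.
From mathcomp Require Import all_boot all_order all_algebra.
From mathcomp Require Import all_classical all_reals all_analysis.
Import Order.TTheory GRing.Theory Num.Theory.
Import numFieldNormedType.Exports.

Set Implicit Arguments.
Unset Strict Implicit.
Unset Printing Implicit Defensive.

Local Open Scope classical_set_scope.
Local Open Scope ring_scope.

(* The state space E has k.+1 elements and the action space U has l.+1
   elements, so that both are finite and nonempty. *)
Record mdp (R : realType) (k l : nat) := MDP {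
  trans : 'I_l.+1 -> 'M[R]_k.+1;
  trans_ge0 : forall a x y, 0 <= trans a x y;
  trans_sum1 : forall a x, \sum_y trans a x y = 1;
  reward : 'I_k.+1 -> 'I_l.+1 -> R
}.

(* [a_n] is [pi n], a function of the [n.+1]-tuple (X_0, ..., X_n). *)
Definition policy (k l : nat) := forall n, n.+1.-tuple 'I_k.+1 -> 'I_l.+1.

Definition markov_policy (k l : nat) := nat -> 'I_k.+1 -> 'I_l.+1.

Definition stationary_policy (k l : nat) := 'I_k.+1 -> 'I_l.+1.

Definition policy_of_markov k l (u : markov_policy k l) : policy k l :=
  fun n h => u n (tnth h ord_max).

Definition markov_of_stationary k l (u : stationary_policy k l) :
  markov_policy k l := fun=> u.

(* Canonical path space; the coordinate omega n is X_n. *)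

HB.instance Definition _ k := isPointed.Build 'I_k.+1 ord0.

Definition history k (omega : nat -> 'I_k.+1) n : n.+1.-tuple 'I_k.+1 :=
  [tuple omega i | i < n.+1].

Lemma history_eq k (omega omega' : nat -> 'I_k.+1) n :
  history omega n = history omega' n <->
  forall i, (i <= n)%N -> omega i = omega' i.
Proof.
split=> [hh i ni|hh].
  have := congr1 (fun h => tnth h (Ordinal (ni : (i < n.+1)%N))) hh.
  by rewrite !tnth_mktuple.
by apply: eq_from_tnth => i; rewrite !tnth_mktuple hh// -ltnS.
Qed.

Lemma historyK k n (h : n.+1.-tuple 'I_k.+1) : history (nth ord0 h) n = h.
Proof. by apply: eq_from_tnth => i; rewrite tnth_mktuple (tnth_nth ord0). Qed.

Definition cylinder k n (h : n.+1.-tuple 'I_k.+1) : set (nat -> 'I_k.+1) :=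
  [set omega | history omega n = h].

Definition cylinders k : set (set (nat -> 'I_k.+1)) :=
  [set A | exists n (h : n.+1.-tuple 'I_k.+1), A = cylinder h].

Definition trajectory k := g_sigma_algebraType (@cylinders k).

HB.instance Definition _ k := Measurable.on (trajectory k).

(* P is the law of the state process started at x and controlled by pi: X_0 = x
   almost surely, and the conditional probability of X_{n+1} = y given
   (X_0, ..., X_n) = h is p_{a_n(h)}(h_n, y). *)
Definition is_law (R : realType) k l (M : mdp R k l) (x : 'I_k.+1)
    (pi : policy k l) (P : set (trajectory k) -> \bar R) :=
  P [set omega | omega 0%N = x] = 1%E /\
  forall n (h : n.+1.-tuple 'I_k.+1) (y : 'I_k.+1),
    P (cylinder h `&` [set omega | omega n.+1 = y]) =
    (P (cylinder h) * (trans M (pi n h) (tnth h ord_max) y)%:E)%E.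

Lemma cylinderS k n (h : n.+1.-tuple 'I_k.+1) (y : 'I_k.+1) omega :
  history omega n = h -> omega n.+1 = y ->
  cylinder h `&` [set w | w n.+1 = y] = cylinder (history omega n.+1).
Proof.
move=> <- <-; apply/seteqP; split=> w; rewrite /cylinder/= !history_eq.
  by move=> [e wy] i; rewrite leq_eqVlt ltnS => /predU1P[->|/e].
by move=> e; split=> [i ni|]; apply: e => //; exact: leqW.
Qed.

Lemma cylinder0 k (y : 'I_k.+1) (omega : nat -> 'I_k.+1) : omega 0%N = y ->
  [set w : trajectory k | w 0%N = y] = cylinder (history omega 0).
Proof.
move=> <-; apply/seteqP; split=> w; rewrite /cylinder/= history_eq; last exact.
by move=> e i; rewrite leqn0 => /eqP ->.
Qed.

Lemma is_law_unique (R : realType) k l (M : mdp R k l) (x : 'I_k.+1)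
    (pi : policy k l) (P Q : probability (trajectory k) R) :
  is_law M x pi P -> is_law M x pi Q ->
  forall A : set (trajectory k), measurable A -> P A = Q A.
Proof.
move=> [P0 PS] [Q0 QS].
have mcyl n (h : n.+1.-tuple 'I_k.+1) : measurable (cylinder h : set (trajectory k)).
  by apply: sub_sigma_algebra; exists n, h.
have PQ n (h : n.+1.-tuple 'I_k.+1) : P (cylinder h) = Q (cylinder h).
  elim: n h => [|n IHn] h; last first.
    by rewrite -[h]historyK -(cylinderS erefl erefl) PS QS IHn.
  rewrite -[h]historyK -(cylinder0 erefl); set y := nth _ _ _.
  have [->|yx] := eqVneq y x; first by rewrite P0 Q0.
  have mx : measurable [set w : trajectory k | w 0%N = x].
    by rewrite (@cylinder0 _ _ (fun=> x))//; exact: mcyl.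
  have null (S : probability (trajectory k) R) :
      S [set w | w 0%N = x] = 1%E -> S [set w | w 0%N = y] = 0%E.
    move=> S1; apply/eqP; rewrite eq_le measure_ge0 andbT.
    have <- : S (~` [set w | w 0%N = x]) = 0%E by rewrite probability_setC// S1 subee.
    apply: le_measure; rewrite ?inE.
    - by rewrite (@cylinder0 _ _ (fun=> y))//; exact: mcyl.
    - exact: measurableC.
    - by move=> w /= -> /eqP; exact/negP.
  by rewrite !null.
pose G : set (set (trajectory k)) := [set A | [\/ A = set0, A = setT | @cylinders k A]].
have Gm : G `<=` measurable.
  move=> A [->|->|[n [h ->]]]; [exact: measurable0|exact: measurableT|exact: mcyl].
move=> A mA; apply: (@g_sigma_algebra_measure_unique _ _ _ G Gm (fun=> setT)).
- by move=> _; apply: Or32.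
- by rewrite bigcup_const//; exists 0%N.
- move=> B C [->|->|[n [h ->]]]; rewrite ?set0I ?setTI//; first by move=> _; apply: Or31.
  move=> [->|->|[m [h' ->]]]; rewrite ?setI0 ?setIT//; first exact: Or31.
  + by apply: Or33; exists n, h.
  have [nm|mn] := leqP n m.
  + have [e|ne] := pselect (cylinder h (nth ord0 h')).
      apply: Or33; exists m, h'; apply/setIidPr => w; rewrite /cylinder/= -e -[h']historyK.
      by rewrite !history_eq => e' i ni; rewrite e' ?historyK// (leq_trans ni).
    apply: Or31; apply/seteqP; split=> // w [hw hw']; apply: ne.
    move: hw hw'; rewrite /cylinder/= => <-; rewrite -[X in _ = X]historyK !history_eq.
    by move=> e i ni; rewrite e// (leq_trans ni).
  + have [e|ne] := pselect (cylinder h' (nth ord0 h)).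
      apply: Or33; exists n, h; apply/setIidPl => w; rewrite /cylinder/= -e -[h]historyK.
      by rewrite !history_eq => e' i ni; rewrite e' ?historyK// (leq_trans ni)// ltnW.
    apply: Or31; apply/seteqP; split=> // w [hw' hw]; apply: ne.
    move: hw hw'; rewrite /cylinder/= => <-; rewrite -[X in _ = X]historyK !history_eq.
    by move=> e i ni; rewrite e// (leq_trans ni)// ltnW.
- move=> B [->|->|[n [h ->]]]; last exact: PQ.
  + by rewrite !measure0.
  + exact: etrans (probability_setT P) (esym (probability_setT Q)).
- by move=> _; rewrite (le_lt_trans (probability_le1 P _)) ?ltry.
- by apply: (sub_sigma_algebra2 _ mA) => B; exact: Or33.
Qed.

(* Existence of the law: the interval [0, 1[ is split successively according to
   the transition probabilities, and the law is the image of the Lebesgue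
   measure on [0, 1[ under the map sending a point to the trajectory of the
   cells that contain it. *)
Section law_existence.
Context (R : realType) (k l : nat) (M : mdp R k l).
Context (x : 'I_k.+1) (pi : policy k l).
Implicit Types (omega : nat -> 'I_k.+1) (u : R).

Let step omega n : 'I_k.+1 -> R := trans M (pi (history omega n)) (omega n).

Let cumul omega n (m : nat) : R := \sum_(z : 'I_k.+1 | (z < m)%N) step omega n z.

Fixpoint cell_length omega n : R :=
  if n is m.+1 then cell_length omega m * step omega m (omega m.+1)
  else (omega 0%N == x)%:R.

Fixpoint cell_left omega n : R :=
  if n is m.+1 then cell_left omega m + cell_length omega m * cumul omega m (omega m.+1)
  else 0.

Let cell omega n : set R :=
  `[cell_left omega n, cell_left omega n + cell_length omega n[.

Let cell_length_ge0 omega n : 0 <= cell_length omega n.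
Proof.
by elim: n => [|n IHn] /=; rewrite ?ler0n// mulr_ge0 ?trans_ge0.
Qed.

Let cumulS omega n (y : 'I_k.+1) : cumul omega n y.+1 = cumul omega n y + step omega n y.
Proof.
rewrite /cumul (bigD1 y)//= addrC; congr (_ + _); apply: eq_bigl => z.
by rewrite ltnS andbC -ltn_neqAle.
Qed.

Let cumul_le omega n m m' : (m <= m')%N -> cumul omega n m <= cumul omega n m'.
Proof.
move=> mm'; rewrite /cumul [leRHS](bigID (fun z : 'I_k.+1 => (z < m)%N))/=.
rewrite (eq_bigl (fun z : 'I_k.+1 => (z < m')%N && (z < m)%N)); last first.
  by move=> z; case: (ltnP z m) => zm; rewrite ?andbF// (leq_trans zm).
by rewrite lerDl sumr_ge0// => z _; exact: trans_ge0.
Qed.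

Let cumul0 omega n : cumul omega n 0 = 0.
Proof. by rewrite /cumul big_pred0. Qed.

Let cumul1 omega n : cumul omega n k.+1 = 1.
Proof.
by rewrite -(trans_sum1 M (pi (history omega n)) (omega n)); apply: eq_bigl => z; rewrite ltn_ord.
Qed.

Let cell_ext omega omega' n : (forall i, (i <= n)%N -> omega i = omega' i) ->
  cell_length omega n = cell_length omega' n /\ cell_left omega n = cell_left omega' n.
Proof.
elim: n => [|n IHn] /= hh; first by rewrite hh.
have hn i : (i <= n)%N -> omega i = omega' i by move=> ni; exact/hh/leqW.
have st : step omega n = step omega' n.
  by rewrite /step hn// ((history_eq omega omega' n).2 hn).
have [-> ->] := IHn hn.
by rewrite /cumul st hh.
Qed.

Let upd omega n (y : 'I_k.+1) : nat -> 'I_k.+1 :=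
  fun i => if i == n then y else omega i.

Let updS omega n y i : (i <= n)%N -> upd omega n.+1 y i = omega i.
Proof. by rewrite /upd; case: eqP => // -> /[!ltnn]. Qed.

Let cellS omega n u : cell omega n.+1 u ->
  cell_left omega n + cell_length omega n * cumul omega n (omega n.+1) <= u /\
  u < cell_left omega n + cell_length omega n * cumul omega n (omega n.+1).+1.
Proof.
by rewrite /cell/= in_itv/= cumulS mulrDr addrA => /andP.
Qed.

Let cell_sub omega n : cell omega n.+1 `<=` cell omega n.
Proof.
move=> u /cellS[h1 h2]; rewrite /cell/= in_itv/=; apply/andP; split.
  rewrite (le_trans _ h1)// lerDl mulr_ge0//.
  by rewrite -(cumul0 omega n) cumul_le.
rewrite (lt_le_trans h2)// lerD2l ler_piMr//.
by rewrite -(cumul1 omega n) cumul_le.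
Qed.

Let cell_split omega n u : cell omega n u -> exists y, cell (upd omega n.+1 y) n.+1 u.
Proof.
move=> /=; rewrite /cell/= in_itv/= => /andP[lou uhi].
have ex : exists m, u < cell_left omega n + cell_length omega n * cumul omega n m.
  by exists k.+1; rewrite cumul1 mulr1.
case: (ex_minnP ex) => -[|m] Hm minm.
  by move: Hm; rewrite cumul0 mulr0 addr0 ltNge lou.
have mk : (m < k.+1)%N by apply: minm; rewrite cumul1 mulr1.
exists (Ordinal mk).
have [h1 h2] := @cell_ext (upd omega n.+1 (Ordinal mk)) omega n (fun i ni => updS omega (Ordinal mk) ni).
have st : step (upd omega n.+1 (Ordinal mk)) n = step omega n.
  rewrite /step updS//.
  by rewrite ((history_eq (upd omega n.+1 (Ordinal mk)) omega n).2 (fun i ni => updS omega (Ordinal mk) ni)).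
rewrite /cell/= in_itv/= h1 h2 /cumul st /upd eqxx -/(cumul omega n (Ordinal mk)).
rewrite -addrA -mulrDr -cumulS Hm andbT leNgt; apply/negP => /minm.
by rewrite ltnn.
Qed.

Let cell_disj omega omega' n u : cell omega n u -> cell omega' n u ->
  forall i, (i <= n)%N -> omega i = omega' i.
Proof.
elim: n => [|n IHn] hu hu'.
  suff e w : cell w 0 u -> w 0%N = x by move=> i; rewrite leqn0 => /eqP ->; rewrite !e.
  rewrite /cell/= in_itv/= add0r; case: eqP => //= _.
  by move=> /andP[/le_lt_trans h /h]; rewrite ltxx.
have hn := IHn (cell_sub hu) (cell_sub hu').
have st : step omega n = step omega' n.
  by rewrite /step hn// ((history_eq omega omega' n).2 hn).
move=> i; rewrite leq_eqVlt => /predU1P[->|]; last by rewrite ltnS; exact: hn.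
have [h1 h2] := cellS hu; have [] := cellS hu'.
have [<- <-] := cell_ext hn; rewrite /cumul -st => h1' h2'.
apply/val_inj/eqP; rewrite eqn_leq; apply/andP; split; rewrite leqNgt; apply/negP => yy.
  have := le_lt_trans h1 h2'; rewrite ltNge lerD2l ler_wpM2l//.
  exact: (cumul_le omega n yy).
have := le_lt_trans h1' h2; rewrite ltNge lerD2l ler_wpM2l//.
exact: (cumul_le omega n yy).
Qed.

Let cell01 omega n : cell omega n `<=` `[0, 1[.
Proof.
elim: n => [|n IHn]; last by apply: subset_trans IHn; exact: cell_sub.
rewrite /cell/= add0r => u; rewrite /= !in_itv/= => /andP[-> /lt_le_trans]; apply.
by rewrite lern1 leq_b1.
Qed.

Let approx u := fix approx n : nat -> 'I_k.+1 :=
  if n is m.+1 then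
    upd (approx m) m.+1 (xget ord0 [set y | cell (upd (approx m) m.+1 y) m.+1 u])
  else fun=> x.

Let approx_cell u n : `[0, 1[%classic u -> cell (approx u n) n u.
Proof.
move=> u01; elim: n => [|n IHn].
  by rewrite /cell/= eqxx add0r.
have [y hy] := cell_split IHn.
exact: (@xgetI _ ord0 [set y | cell (upd (approx u n) n.+1 y) n.+1 u] y hy).
Qed.

Let approx_le u i n : (i <= n)%N -> approx u n i = approx u i i.
Proof.
elim: n => [|n IHn]; first by rewrite leqn0 => /eqP ->.
rewrite leq_eqVlt => /predU1P[->//|]; rewrite ltnS => ni.
by rewrite /= updS// IHn.
Qed.

Definition cell_trajectory (u : measurableTypeR R) : trajectory k :=
  if (u : R) \in `[0, 1[ then fun i => approx u i i else fun=> x.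

Let trajectory_cell u n : `[0, 1[%classic u -> cell (cell_trajectory u) n u.
Proof.
move=> u01; rewrite /cell_trajectory ifT//; have := approx_cell n u01.
have [|e1 e2] := @cell_ext (approx u n) (fun i => approx u i i) n.
  by move=> i; exact: approx_le.
by rewrite /cell e1 e2.
Qed.

Let preimage_cylinder omega n :
  cell_trajectory @^-1` cylinder (history omega n) `&` `[0, 1[ = cell omega n.
Proof.
apply/seteqP; split=> u.
  move=> [/= /history_eq e u01]; have := trajectory_cell n u01.
  by have [e1 e2] := cell_ext e; rewrite /cell e1 e2.
move=> hu; have u01 := cell01 hu; split=> //=.
by apply/history_eq; exact: (cell_disj (trajectory_cell n u01) hu).
Qed.

Let measurable_cell_trajectory : measurable_fun setT cell_trajectory.
Proof.
apply: (@measurability _ _ (measurableTypeR R) (trajectory k) setT cell_trajectory (@cylinders k) erefl).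
move=> _ [_ [n [h ->]] <-]; rewrite setTI -[X in measurable X](setUIDK _ `[0, 1[%classic).
apply: measurableU.
  by rewrite -(historyK h) preimage_cylinder; exact: measurable_itv.
have [hx|hx] := pselect (cylinder h (fun=> x)).
  rewrite (_ : _ `\` _ = ~` `[0, 1[%classic); first by apply: measurableC; exact: measurable_itv.
  apply/seteqP; split=> u /=; first by case.
  by move=> u01; split=> //; rewrite /cell_trajectory ifF//; exact/negP.
rewrite (_ : _ `\` _ = set0)//; apply/seteqP; split=> u //= -[].
by rewrite /cell_trajectory; case: ifPn.
Qed.

HB.instance Definition _ :=
  @isMeasurableFun.Build _ _ _ _ cell_trajectory measurable_cell_trajectory.

Definition lebesgue01 : set (measurableTypeR R) -> \bar R :=
  mrestr lebesgue_measure (measurable_itv `[0, 1[).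

HB.instance Definition _ := Measure.on lebesgue01.

Let lebesgue01T : lebesgue01 setT = 1%E.
Proof.
by rewrite /lebesgue01 /mrestr setTI lebesgue_measure_itv/= lte_fin ltr01 oppr0 adde0.
Qed.

HB.instance Definition _ := Measure_isProbability.Build _ _ _ lebesgue01 lebesgue01T.

Lemma law_exists : exists P : probability (trajectory k) R, is_law M x pi P.
Proof.
pose P : probability (trajectory k) R := distribution lebesgue01 cell_trajectory.
exists P; have mP omega n : P (cylinder (history omega n)) = (cell_length omega n)%:E.
  rewrite /P/= /distribution /pushforward /lebesgue01 /mrestr preimage_cylinder.
  rewrite /cell lebesgue_measure_itv/= lte_fin ltrDl.
  case: ltP => [_|c0]; first by rewrite -EFinB addrC addKr.
  by congr EFin; apply/le_anti; rewrite cell_length_ge0.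
split=> [|n h y].
  by rewrite (@cylinder0 _ _ (fun=> x))// (mP (fun=> x) 0%N)/= eqxx.
pose omega := upd (nth ord0 h) n.+1 y.
have oE : history omega n = h.
  by rewrite -[RHS]historyK; apply/history_eq => i; exact: updS.
have oy : omega n.+1 = y by rewrite /omega /upd eqxx.
rewrite (cylinderS oE oy) -oE !mP/= oy EFinM /step tnth_mktuple.
by [].
Qed.

End law_existence.

Definition law (R : realType) k l (M : mdp R k l) (x : 'I_k.+1)
  (pi : policy k l) : probability (trajectory k) R := sval (cid (law_exists M x pi)).

Lemma lawP (R : realType) k l (M : mdp R k l) (x : 'I_k.+1) (pi : policy k l) :
  is_law M x pi (law M x pi).
Proof. exact: svalP (cid (law_exists M x pi)). Qed.

Definition total_reward (R : realType) k l (M : mdp R k l) (beta : R)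
    (pi : policy k l) (omega : trajectory k) : R :=
  limn (fun n => \sum_(0 <= i < n)
    beta ^+ i * reward M (omega i) (pi i (history omega i))).

Definition J (R : realType) k l (M : mdp R k l) (gamma : R) (x : 'I_k.+1)
    (pi : policy k l) (beta : R) : R :=
  if gamma == 0 then fine 'E_(law M x pi)[total_reward M beta pi]
  else gamma^-1 * ln (fine 'E_(law M x pi)
                       [fun omega => expR (gamma * total_reward M beta pi omega)]).

Definition optimal (R : realType) k l (M : mdp R k l) (beta gamma : R) :
    set (markov_policy k l) :=
  [set u | forall x, (J M gamma x (policy_of_markov u) beta)%:E =
    ereal_sup [set (J M gamma x pi beta)%:E | pi in [set: policy k l]]].

Definition left_thresholds (R : realType) k l (M : mdp R k l) (beta : R) :
    set R :=
  [set gamma0 | gamma0 < 0 /\ exists u : stationary_policy k l,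
    forall gamma, gamma0 <= gamma <= 0 ->
      optimal M beta gamma (markov_of_stationary u)].

Definition right_thresholds (R : realType) k l (M : mdp R k l) (beta : R) :
    set R :=
  [set gamma0 | 0 < gamma0 /\ exists u : stationary_policy k l,
    forall gamma, 0 <= gamma <= gamma0 ->
      optimal M beta gamma (markov_of_stationary u)].

Definition gamma_left (R : realType) k l (M : mdp R k l) (beta : R) : \bar R :=
  ereal_inf (EFin @` left_thresholds M beta).

Definition gamma_right (R : realType) k l (M : mdp R k l) (beta : R) : \bar R :=
  ereal_sup (EFin @` right_thresholds M beta).

Definition upper_semicontinuous (X : topologicalType) (R : numFieldType)
    (f : X -> \bar R) :=
  forall x a, (f x < a%:E)%E ->
    exists2 V, nbhs x V & forall y, V y -> (f y < a%:E)%E.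

(* Main.v *)
Require Import Defs.
From mathcomp Require Import all_boot all_order all_algebra.
From mathcomp Require Import all_classical all_reals all_analysis.
From mathcomp Require Import measurable_realfun ring lra.
Import Order.TTheory GRing.Theory Num.Theory.
Import numFieldNormedType.Exports.
Set Implicit Arguments.
Unset Strict Implicit.
Unset Printing Implicit Defensive.
Local Open Scope classical_set_scope.
Local Open Scope ring_scope.

(** Write the risk parameter as [g = s * t] with [s = 1] or [s = -1] and [0 <= t],
    and let [mgf g x pi] be the expectation of [expR (g * S)], where [S] is the
    total discounted reward. For [0 < t], a policy beats another one for the
    criterion [J] exactly when it beats it for [s * mgf] ([le_J]), so that both
    sides of zero are the same problem, with the sign [s] as a parameter.

    A stationary policy [u] satisfies the dynamic programming equation
    [mgf_stationary], which relates the risk parameter [g] to [g * b]. The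
    parameters [g * b ^+ n] of the later stages never leave the interval between
    [0] and [g], and [mgf (g * b ^+ n)] tends to [1]; hence an inequality between
    [mgf] and its one-step update that holds for all small [t] can be iterated
    along any policy, even a history-dependent one ([verification]).

    As a function of [g], [mgf] is analytic, so the difference of two policies
    has a constant sign for small [t > 0] ([mgf_sign]): at each state, policies
    are totally preordered by their behaviour next to zero. Policy improvement for this
    preorder, over the finitely many stationary policies, yields one that is
    optimal for all small [t > 0] ([exists_small_risk_optimal]), and also for
    [t = 0] because the mean reward is the first-order term of [mgf].

    Finally, the criterion is continuous in the risk parameter and in the
    discount factor. Optimality of a given [u] thus passes to limits in [t]
    ([dominates_left_limit]), and failure of optimality at a given [t] persists
    under small changes of the discount factor ([not_dominates_near]). As there
    are finitely many [u], the first fact makes the supremum of the thresholds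
    attained ([threshold_attained]) and the second makes it upper
    semicontinuous ([threshold_lt_near]). The supremum for [s = -1] is the
    opposite of [gamma_left], whence the lower semicontinuity on the left. *)

(** * Discounted sums of bounded sequences *)

Section discounted_sums.
Context {R : realType}.
Implicit Types (b C : R) (r : nat -> R).

Definition discounted b r n : R := \sum_(0 <= i < n) b ^+ i * r i.

Lemma discountedS b r n :
  discounted b r n.+1 = r 0%N + b * discounted b (fun i => r i.+1) n.
Proof.
rewrite /discounted big_nat_recl// expr0 mul1r mulr_sumr; congr (_ + _).
by apply: eq_bigr => i _; rewrite exprS mulrA.
Qed.

Lemma discountedD b r n m : discounted b r (n + m) =
  discounted b r n + b ^+ n * discounted b (fun i => r (n + i)%N) m.
Proof.
rewrite /discounted (big_cat_nat (leq0n n) (leq_addr m n))/=; congr (_ + _).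
rewrite -{1}[n]add0n big_addn addKn mulr_sumr; apply: eq_bigr => i _.
by rewrite addnC exprD mulrA.
Qed.

Lemma discounted_bound b C r n : 0 <= b < 1 -> (forall i, `|r i| <= C) ->
  `|discounted b r n| <= C / (1 - b).
Proof.
move=> /andP[b0 b1]; have b1' : 0 < 1 - b by lra.
elim: n r => [|n IHn] r rC.
  by rewrite /discounted big_nil normr0 divr_ge0 ?(ltW b1')// (le_trans _ (rC 0%N)).
rewrite discountedS (le_trans (ler_normD _ _))//.
have -> : C / (1 - b) = C + b * (C / (1 - b)) by field; rewrite gt_eqF.
by rewrite lerD// normrM (ger0_norm b0) ler_wpM2l// IHn.
Qed.

(** Splitting off the first term gives the fixed-point inequality
    [D <= |b - b'| * C / (1 - q) + q * D] for the largest distance [D]. *)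
Lemma discounted_lipschitz b b' q C r n : 0 <= b <= q -> 0 <= b' <= q -> q < 1 ->
  (forall i, `|r i| <= C) ->
  `|discounted b r n - discounted b' r n| <= `|b - b'| * (C / (1 - q) ^+ 2).
Proof.
move=> /andP[b0 bq] /andP[b'0 b'q] q1; have q1' : 0 < 1 - q by lra.
elim: n r => [|n IHn] r rC.
  rewrite /discounted !big_nil subrr normr0 mulr_ge0// divr_ge0 ?exprn_ge0 ?(ltW q1')//.
  exact: le_trans (normr_ge0 _) (rC 0%N).
rewrite !discountedS; set r' := fun i => _.
have -> : r 0%N + b * discounted b r' n - (r 0%N + b' * discounted b' r' n) =
  (b - b') * discounted b r' n + b' * (discounted b r' n - discounted b' r' n) by ring.
rewrite (le_trans (ler_normD _ _))// !normrM.
have -> : `|b - b'| * (C / (1 - q) ^+ 2) =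
    `|b - b'| * (C / (1 - q)) + q * (`|b - b'| * (C / (1 - q) ^+ 2)).
  by field; rewrite gt_eqF.
have rC' i : `|r' i| <= C by exact: rC.
apply: lerD.
  rewrite ler_wpM2l//.
  have b1 : 0 <= b < 1 by rewrite b0 (le_lt_trans bq).
  rewrite (le_trans (discounted_bound n b1 rC'))// ler_wpM2l ?(le_trans _ (rC 0%N))//.
  by rewrite lef_pV2 ?posrE//; lra.
by rewrite ler_pM ?IHn// ger0_norm.
Qed.

Lemma is_cvg_discounted b C r : 0 <= b < 1 -> (forall i, `|r i| <= C) ->
  cvgn (discounted b r).
Proof.
move=> /andP[b0 b1] rC; apply: (@normed_cvg _ _ (fun i => b ^+ i * r i)).
apply: (@series_le_cvg _ _ (fun i => C * b ^+ i)) => [i|i|i|].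
- exact: normr_ge0.
- by rewrite mulr_ge0 ?exprn_ge0// (le_trans _ (rC i)).
- by rewrite /= normrM mulrC ler_pM// ger0_norm// exprn_ge0.
- by apply: is_cvg_geometric_series; rewrite ger0_norm.
Qed.

Lemma discounted_tail b C r n : 0 <= b < 1 -> (forall i, `|r i| <= C) ->
  `|discounted b r n - limn (discounted b r)| <= b ^+ n * (C / (1 - b)).
Proof.
move=> b01 rC; have cv := is_cvg_discounted b01 rC.
have cvn : (fun m => `|discounted b r n - discounted b r m|) @ \oo -->
    `|discounted b r n - limn (discounted b r)|.
  by apply: cvg_norm; apply: cvgB => //; exact: cvg_cst.
apply: (cvgr_to_le cvn); near=> m.
have nm : (n <= m)%N by near: m; exact: nbhs_infty_ge.
rewrite -(subnKC nm) discountedD opprD addrA subrr sub0r normrN normrM.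
have /andP[b0 _] := b01.
rewrite ger0_norm ?exprn_ge0// ler_wpM2l ?exprn_ge0//.
exact: discounted_bound.
Unshelve. all: by end_near. Qed.

End discounted_sums.

(** * Expectations of bounded random variables *)

Section bounded_expectation.
Context d (T : measurableType d) (R : realType) (P : probability T R).
Implicit Types f g : T -> R.

Definition bounded_measurable f :=
  measurable_fun setT f /\ exists B, forall w, `|f w| <= B.

Lemma bounded_measurable_cst c : bounded_measurable (fun=> c).
Proof. by split; [exact: measurable_cst|exists `|c|]. Qed.

Lemma bounded_measurableD f g : bounded_measurable f -> bounded_measurable g ->
  bounded_measurable (fun w => f w + g w).
Proof.
move=> [mf [B fB]] [mg [B' gB']]; split; first exact: measurable_funD.
by exists (B + B') => w; rewrite (le_trans (ler_normD _ _))// lerD.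
Qed.

Lemma bounded_measurableM f g : bounded_measurable f -> bounded_measurable g ->
  bounded_measurable (fun w => f w * g w).
Proof.
move=> [mf [B fB]] [mg [B' gB']]; split; first exact: measurable_funM.
by exists (B * B') => w; rewrite normrM ler_pM.
Qed.

Lemma bounded_measurableZ c f : bounded_measurable f ->
  bounded_measurable (fun w => c * f w).
Proof. exact/bounded_measurableM/bounded_measurable_cst. Qed.

Lemma bounded_measurableX f n : bounded_measurable f ->
  bounded_measurable (fun w => f w ^+ n).
Proof.
move=> bf; elim: n => [|n IHn].
  by under eq_fun do rewrite expr0; exact: bounded_measurable_cst.
by under eq_fun do rewrite exprS; exact: bounded_measurableM.
Qed.

Lemma bounded_measurable_sum I (r : seq I) (F : I -> T -> R) :
  (forall i, bounded_measurable (F i)) ->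
  bounded_measurable (fun w => \sum_(i <- r) F i w).
Proof.
move=> bF; elim: r => [|i r IHr].
  by under eq_fun do rewrite big_nil; exact: bounded_measurable_cst.
by under eq_fun do rewrite big_cons; exact: bounded_measurableD.
Qed.

Lemma bounded_measurable_expR f : bounded_measurable f ->
  bounded_measurable (fun w => expR (f w)).
Proof.
move=> [mf [B fB]]; split; first exact: measurableT_comp.
by exists (expR B) => w; rewrite ger0_norm ?expR_ge0// ler_expR (le_trans (ler_norm _)).
Qed.

Lemma bounded_measurable_integrable f : bounded_measurable f ->
  P.-integrable setT (EFin \o f).
Proof.
move=> [mf [B fB]]; apply: measurable_bounded_integrable => //.
  by rewrite (le_lt_trans (probability_le1 P measurableT))// ltry.
by exists B; split; [exact: num_real|move=> y By w _ /=; rewrite (le_trans (fB w))// ltW].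
Qed.

Local Notation E f := (\int[P]_w f w).

Lemma fine_expectation f : fine 'E_P[f] = E f.
Proof. by rewrite unlock. Qed.

Lemma mean_cst c : E (fun=> c) = c.
Proof.
rewrite [LHS]Rintegral_cst// -[RHS]mulr1; congr (_ * _).
exact: (congr1 (@fine R) (probability_setT P)).
Qed.

Lemma meanD f g : bounded_measurable f -> bounded_measurable g ->
  E (fun w => f w + g w) = E f + E g.
Proof. by move=> bf bg; apply: RintegralD => //; exact: bounded_measurable_integrable. Qed.

Lemma meanZ c f : bounded_measurable f -> E (fun w => c * f w) = c * E f.
Proof. by move=> bf; apply: RintegralZl => //; exact: bounded_measurable_integrable. Qed.

Lemma mean_sum I (r : seq I) (F : I -> T -> R) :
  (forall i, bounded_measurable (F i)) ->
  E (fun w => \sum_(i <- r) F i w) = \sum_(i <- r) E (F i).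
Proof.
move=> bF; elim: r => [|i r IHr].
  by under eq_fun do rewrite big_nil; rewrite big_nil mean_cst.
under eq_fun do rewrite big_cons.
by rewrite big_cons meanD ?IHr//; exact: bounded_measurable_sum.
Qed.

Lemma le_mean f g : bounded_measurable f -> bounded_measurable g ->
  (forall w, f w <= g w) -> E f <= E g.
Proof.
by move=> bf bg fg; apply: le_Rintegral => //; exact: bounded_measurable_integrable.
Qed.

Lemma mean_near f g e : bounded_measurable f -> bounded_measurable g ->
  (forall w, `|f w - g w| <= e) -> `|E f - E g| <= e.
Proof.
move=> bf bg fge; rewrite ler_distl.
have be := bounded_measurable_cst; apply/andP; split.
  rewrite -(mean_cst (- e)) -meanD//; apply: le_mean => //; first exact: bounded_measurableD.
  by move=> w; have := fge w; rewrite ler_distl => /andP[].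
rewrite -[X in _ <= _ + X](mean_cst e) -meanD//; apply: le_mean => //; first exact: bounded_measurableD.
by move=> w; have := fge w; rewrite ler_distl => /andP[].
Qed.

Lemma mean_indic A : measurable A -> E (\1_A : T -> R) = fine (P A).
Proof. by move=> mA; rewrite /Rintegral integral_indic// setIT. Qed.

Lemma bounded_measurable_indic A : measurable A ->
  bounded_measurable (\1_A : T -> R).
Proof.
move=> mA; split; first exact: measurable_indic.
by exists 1 => w; rewrite ger0_norm ?indic_ge0// indicE lern1 leq_b1.
Qed.

End bounded_expectation.

(** * The controlled process *)

Section process.
Context {R : realType} {k l : nat} (M : mdp R k l).
Implicit Types (pi : policy k l) (w : trajectory k).

(** Measurability with respect to [X_0, ..., X_n], without a filtration: the
    state space is finite, so invariance on the cylinders of level [n] suffices. *)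
Definition observed n (f : trajectory k -> R) :=
  forall w w', history w n = history w' n -> f w = f w'.

Lemma measurable_cylinder n (h : n.+1.-tuple 'I_k.+1) :
  measurable (cylinder h : set (trajectory k)).
Proof. by apply: sub_sigma_algebra; exists n, h. Qed.

Lemma observed_expand n f : observed n f ->
  f = fun w => \sum_(h : n.+1.-tuple 'I_k.+1) f (nth ord0 h) * \1_(cylinder h) w.
Proof.
move=> of_; apply/funext => w; rewrite (bigD1 (history w n))//= big1 => [|h hw].
  rewrite addr0 indicE mem_set// mulr1; apply: of_.
  exact: esym (historyK (history w n)).
rewrite indicE memNset ?mulr0//.
by move=> /= e; rewrite e eqxx in hw.
Qed.

Lemma observed_bounded_measurable n f : observed n f -> bounded_measurable f.
Proof.
move=> /observed_expand ->; apply: bounded_measurable_sum => h.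
by apply/bounded_measurableZ/bounded_measurable_indic; exact: measurable_cylinder.
Qed.

Lemma observed_state n m (g : 'I_k.+1 -> R) : (m <= n)%N ->
  observed n (fun w => g (w m)).
Proof. by move=> mn w w' /history_eq e; rewrite e. Qed.

Lemma history_prefix w w' n m : (m <= n)%N -> history w n = history w' n ->
  history w m = history w' m.
Proof. by move=> mn /history_eq e; apply/history_eq => i im; rewrite e// (leq_trans im). Qed.

Lemma observed_history n m (g : m.+1.-tuple 'I_k.+1 -> 'I_k.+1 -> R) : (m <= n)%N ->
  observed n (fun w => g (history w m) (w m)).
Proof.
by move=> mn w w' e; rewrite (history_prefix mn e); move/history_eq : e => ->.
Qed.

Lemma observedM n f g : observed n f -> observed n g -> observed n (fun w => f w * g w).
Proof. by move=> of_ og w w' e; rewrite (of_ _ _ e) (og _ _ e). Qed.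

Lemma cylinder_last n (h : n.+1.-tuple 'I_k.+1) w : cylinder h w ->
  w n = tnth h ord_max.
Proof. by move=> <-; rewrite tnth_mktuple. Qed.

(** The Markov property: [f] is constant on each cylinder of level [n], and
    [is_law] gives the probability of extending that cylinder by one state. *)
Lemma mean_step x pi n (f : trajectory k -> R) (g : 'I_k.+1 -> R) : observed n f ->
  \int[law M x pi]_w (f w * g (w n.+1)) =
  \int[law M x pi]_w
    (f w * \sum_y trans M (pi n (history w n)) (w n) y * g y).
Proof.
move=> of_; set P := law M x pi; have [_ PS] := lawP M x pi.
pose A (y : 'I_k.+1) := [set w : trajectory k | w n.+1 = y].
have mA y : measurable (A y).
  apply/(measurable_indicP R).
  rewrite (_ : \1_ _ = fun w : trajectory k => (w n.+1 == y)%:R :> R).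
    by have [] := observed_bounded_measurable (observed_state (fun z => (z == y)%:R) (leqnn n.+1)).
  by apply/funext => w; rewrite indicE; congr ((nat_of_bool _)%:R); apply/idP/eqP => [/set_mem|/mem_set].
have mcA h y : measurable ((cylinder h : set (trajectory k)) `&` A y).
  by apply: measurableI => //; exact: measurable_cylinder.
transitivity (\sum_(h : n.+1.-tuple 'I_k.+1) \sum_y f (nth ord0 h) * g y *
    \int[P]_w \1_(cylinder h `&` A y) w).
  have bA (h : n.+1.-tuple 'I_k.+1) y :
      bounded_measurable (fun w => f (nth ord0 h) * g y * \1_(cylinder h `&` A y) w).
    by apply: bounded_measurableZ; exact: bounded_measurable_indic.
  transitivity (\sum_(h : n.+1.-tuple 'I_k.+1) \sum_y
      \int[P]_w (f (nth ord0 h) * g y * \1_(cylinder h `&` A y) w)); last first.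
    apply: eq_bigr => h _; apply: eq_bigr => y _; rewrite meanZ//.
    exact: bounded_measurable_indic.
  under eq_bigr => h _ do rewrite -mean_sum//.
  rewrite -mean_sum => [|h]; last exact: bounded_measurable_sum.
  congr Rintegral; apply/funext => w.
  rewrite {1}(observed_expand of_) mulr_suml; apply: eq_bigr => h _.
  rewrite (bigD1 (w n.+1))//= big1 => [|y yw].
    rewrite addr0 mulrAC; congr (_ * _ * _); rewrite !indicE; congr ((nat_of_bool _)%:R).
    by apply/idP/idP => /set_mem => [hw|[hw _]]; exact/mem_set.
  by rewrite indicE memNset ?mulr0// => -[_] /= e; rewrite e eqxx in yw.
transitivity (\sum_(h : n.+1.-tuple 'I_k.+1) f (nth ord0 h) *
    (\sum_y trans M (pi n h) (tnth h ord_max) y * g y) *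
    \int[P]_w \1_(cylinder h) w).
  apply: eq_bigr => h _; rewrite mulr_sumr mulr_suml; apply: eq_bigr => y _.
  rewrite !mean_indic//; last exact: measurable_cylinder.
  rewrite PS fineM//=; first by ring.
  by apply: fin_num_measure; exact: measurable_cylinder.
have bcyl (h : n.+1.-tuple 'I_k.+1) :
    bounded_measurable (\1_(cylinder h : set (trajectory k)) : _ -> R).
  by apply: bounded_measurable_indic; exact: measurable_cylinder.
under eq_bigr => h _ do rewrite -meanZ//.
rewrite -mean_sum => [|h]; last exact: bounded_measurableZ.
congr Rintegral; apply/funext => w.
rewrite [in RHS](observed_expand of_) mulr_suml; apply: eq_bigr => h _.
rewrite !indicE; have [/set_mem hw|_] := boolP (w \in cylinder h); last by rewrite !mulr0 mul0r.
by rewrite -(cylinder_last hw) hw; ring.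
Qed.

End process.

(** * The exponential functional and its dynamic programming equation *)

(** From [1 + y <= expR y] applied to the difference of the exponents. *)
Lemma expR_lipschitz {R : realType} (K a c : R) : `|a| <= K -> `|c| <= K ->
  `|expR a - expR c| <= expR K * `|a - c|.
Proof.
wlog ca : a c / c <= a => [hw aK cK|].
  have [/hw|/ltW/hw] := leP c a; first exact.
  by rewrite distrC [`|a - c|]distrC; exact.
move=> aK _; have ac := ca; rewrite -ler_expR in ac.
rewrite !ger0_norm ?subr_ge0//.
have -> : expR a - expR c = expR a * (1 - expR (c - a)).
  by rewrite mulrBr mulr1 -expRD [a + _]addrC subrK.
apply: ler_pM; rewrite ?expR_ge0//.
- by rewrite subr_ge0 expR_le1 subr_le0.
- by rewrite ler_expR (le_trans (ler_norm _)).
- by have := expR_ge1Dx (c - a); lra.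
Qed.

Section exponential_functional.
Context {R : realType} {k l : nat} (M : mdp R k l) (b : R).
Hypothesis b01 : 0 <= b < 1.
Implicit Types (pi : policy k l) (w : trajectory k) (g s : R).

Definition reward_at pi w i : R := reward M (w i) (pi i (history w i)).

Definition reward_bound : R := \sum_x \sum_a `|reward M x a|.

Lemma reward_at_bound pi w i : `|reward_at pi w i| <= reward_bound.
Proof.
rewrite /reward_at /reward_bound; set x := w i; set a := pi _ _.
rewrite (bigD1 x)//= (bigD1 a)//= -addrA lerDl addr_ge0 ?sumr_ge0// => y _.
exact: sumr_ge0.
Qed.

Definition total_bound : R := reward_bound / (1 - b).

Lemma total_bound_ge0 : 0 <= total_bound.
Proof.
apply: le_trans (discounted_bound 0 b01
  (reward_at_bound (fun _ _ => ord0 : 'I_l.+1) (fun=> ord0))).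
exact: normr_ge0.
Qed.

Lemma total_reward_tail pi w n :
  `|discounted b (reward_at pi w) n - total_reward M b pi w| <= b ^+ n * total_bound.
Proof. exact/discounted_tail/reward_at_bound. Qed.

Lemma total_reward_bound pi w : `|total_reward M b pi w| <= total_bound.
Proof.
have := total_reward_tail pi w 0.
by rewrite /discounted big_nil sub0r normrN expr0 mul1r.
Qed.

Lemma partial_reward_bound pi w n : `|discounted b (reward_at pi w) n| <= total_bound.
Proof. exact/discounted_bound/reward_at_bound. Qed.

Lemma observed_reward_at pi n m : (m <= n)%N ->
  observed n (fun w : trajectory k => reward_at pi w m).
Proof. exact: (observed_history (fun h z => reward M z (pi m h))). Qed.

Lemma observed_partial_reward pi n m : (m <= n.+1)%N ->
  observed n (fun w : trajectory k => discounted b (reward_at pi w) m).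
Proof.
move=> mn w w' e; rewrite /discounted !big_mkord; apply: eq_bigr => i _.
by congr (_ * _); apply: observed_reward_at e; rewrite -ltnS (leq_trans (ltn_ord i)).
Qed.

Lemma bounded_measurable_partial_reward pi n :
  bounded_measurable (fun w : trajectory k => discounted b (reward_at pi w) n).
Proof. exact/observed_bounded_measurable/(observed_partial_reward pi (leqnSn n)). Qed.

Lemma bounded_measurable_total_reward pi :
  bounded_measurable (total_reward M b pi : trajectory k -> R).
Proof.
split; last by exists total_bound; exact: total_reward_bound.
apply: (@measurable_fun_cvg _ _ _ _ (fun n (w : trajectory k) => discounted b (reward_at pi w) n)).
  by move=> n; case: (bounded_measurable_partial_reward pi n).
by move=> w _; exact/is_cvg_discounted/reward_at_bound.
Qed.

Definition mgf g x pi : R := \int[law M x pi]_w expR (g * total_reward M b pi w).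

Definition mean_reward x pi : R := \int[law M x pi]_w total_reward M b pi w.

Lemma bounded_measurable_exp g (X : trajectory k -> R) : bounded_measurable X ->
  bounded_measurable (fun w => expR (g * X w)).
Proof. by move=> bX; apply/bounded_measurable_expR/bounded_measurableZ. Qed.

Lemma mgf_lipschitz K g g' x pi : `|g| <= K -> `|g'| <= K ->
  `|mgf g x pi - mgf g' x pi| <= expR (K * total_bound) * total_bound * `|g - g'|.
Proof.
move=> gK g'K; have bT := bounded_measurable_total_reward pi.
apply: mean_near; [exact: bounded_measurable_exp..|move=> w].
rewrite (le_trans (expR_lipschitz (K := K * total_bound) _ _))//.
- by rewrite normrM ler_pM// total_reward_bound.
- by rewrite normrM ler_pM// total_reward_bound.
rewrite -mulrBl normrM -mulrA ler_wpM2l ?expR_ge0// mulrC ler_wpM2r//.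
exact: total_reward_bound.
Qed.

Lemma mgf0 x pi : mgf 0 x pi = 1.
Proof. by rewrite /mgf; under eq_Rintegral => w _ do rewrite mul0r expR0; rewrite mean_cst. Qed.

Lemma mgf_discount_cvg g x pi : mgf (g * b ^+ n) x pi @[n --> \oo] --> (1 : R).
Proof.
have /andP[b0 b1] := b01.
apply/cvgrPdist_le => e e0.
have cv : (fun n => expR (`|g| * total_bound) * total_bound * (`|g| * b ^+ n)) @ \oo --> (0 : R).
  rewrite -(mulr0 (expR (`|g| * total_bound) * total_bound)); apply: cvgMl_tmp.
  rewrite -(mulr0 `|g|); apply: cvgMl_tmp; apply: cvg_expr.
  by rewrite ger0_norm.
near=> n.
have bn : 0 <= b ^+ n <= 1 by rewrite exprn_ge0//= exprn_ile1// ltW.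
rewrite -(mgf0 x pi); apply: (le_trans (mgf_lipschitz (K := `|g|) _ _ _ _)).
- by rewrite normr0.
- by rewrite normrM ler_piMr// ger0_norm; lra.
rewrite sub0r normrN normrM (@ger0_norm _ (b ^+ n)); last by lra.
near: n; exact: (cvgr_le _ cv).
Unshelve. all: by end_near. Qed.

(** The law starts at [x] almost surely only, so both sides are compared up to
    a multiple of the indicator of [X_0 <> x], which has mean zero. *)
Lemma initial_state x pi (f : 'I_k.+1 -> R) :
  \int[law M x pi]_w f (w 0%N) = f x.
Proof.
set P := law M x pi; have [P0 _] := lawP M x pi.
have bm (h : 'I_k.+1 -> R) : bounded_measurable (fun w : trajectory k => h (w 0%N)).
  exact: observed_bounded_measurable (observed_state h (leqnn 0)).
have I1 : \int[P]_w (w 0%N == x)%:R = 1 :> R.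
  transitivity (\int[P]_w \1_[set w : trajectory k | w 0%N = x] w : R).
    congr Rintegral; apply/funext => w; rewrite indicE.
    by congr ((nat_of_bool _)%:R); apply/eqP/idP => [/mem_set|/set_mem].
  rewrite mean_indic ?P0//.
  by rewrite (@cylinder0 _ _ (fun=> x))//; exact: measurable_cylinder.
pose K : R := \sum_y `|f y - f x|.
have fK (w : 'I_k.+1) : `|f w - f x| <= K * (1 - (w == x)%:R).
  have [->|wx] := eqVneq w x; first by rewrite !subrr mulr0 normr0.
  by rewrite subr0 mulr1 /K (bigD1 w)//= lerDl sumr_ge0.
have I0 : \int[P]_w (K * (1 - (w 0%N == x)%:R)) = 0.
  rewrite meanZ; last exact: (bm (fun y => 1 - (y == x)%:R)).
  under eq_Rintegral => w _ do rewrite -mulN1r.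
  rewrite meanD; [|exact: bounded_measurable_cst|].
    rewrite meanZ; last exact: (bm (fun y => (y == x)%:R)).
    by rewrite mean_cst I1 mulN1r subrr mulr0.
  exact/bounded_measurableZ/(bm (fun y => (y == x)%:R)).
apply/eqP; rewrite eq_le; apply/andP; split.
  rewrite -[leRHS]addr0 -I0 -[X in _ <= X + _](mean_cst P) -meanD;
    [|exact: bounded_measurable_cst|exact: (bm (fun y => K * (1 - (y == x)%:R)))].
  apply: le_mean; [exact: bm| |].
    exact: (bm (fun y => f x + K * (1 - (y == x)%:R))).
  by move=> w; have := fK (w 0%N); rewrite ler_distl => /andP[].
rewrite -[leRHS]addr0 -I0 -[leLHS](mean_cst P) -meanD;
  [|exact: bm|exact: (bm (fun y => K * (1 - (y == x)%:R)))].
apply: le_mean; [exact: bounded_measurable_cst| |].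
  exact: (bm (fun y => f y + K * (1 - (y == x)%:R))).
by move=> w; have := fK (w 0%N); rewrite ler_distl => /andP[]; rewrite lerBlDr.
Qed.

(** The one-step operator of the criterion after the change of variables
    [expR (g * _)], which turns the optimality equation into a linear one for
    each fixed action. *)
Definition bellman g a x (G : 'I_k.+1 -> R) : R :=
  expR (g * reward M x a) * \sum_y trans M a x y * G y.

(** The process [expR (g * S_n) * G n X_n] is a supermartingale when [0 <= s]
    and a submartingale when [s <= 0]; a free factor [s] serves both cases. *)
Lemma verification_finite s g x pi (G : nat -> 'I_k.+1 -> R) N :
  (forall n (h : n.+1.-tuple 'I_k.+1), (n < N)%N ->
    s * bellman (g * b ^+ n) (pi n h) (tnth h ord_max) (G n.+1) <=
    s * G n (tnth h ord_max)) ->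
  s * \int[law M x pi]_w
    (expR (g * discounted b (reward_at pi w) N) * G N (w N)) <= s * G 0%N x.
Proof.
elim: N => [|N IHN] GN.
  under eq_Rintegral => w _ do rewrite /discounted big_nil mulr0 expR0 mul1r.
  by rewrite initial_state.
apply: le_trans (IHN _); last by move=> n h nN; apply: GN; exact: leqW.
have oS m : (m <= N.+1)%N ->
    observed N (fun w : trajectory k => expR (g * discounted b (reward_at pi w) m)).
  by move=> mN w w' e; rewrite (observed_partial_reward pi mN e).
rewrite (mean_step M x pi (G N.+1) (oS _ (leqnn _))).
have bmL : bounded_measurable (fun w : trajectory k =>
    expR (g * discounted b (reward_at pi w) N.+1) *
    \sum_y trans M (pi N (history w N)) (w N) y * G N.+1 y).
  apply: (@observed_bounded_measurable _ _ N); apply: observedM; first exact: oS.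
  exact: (observed_history (fun h z => \sum_y trans M (pi N h) z y * G N.+1 y)).
have bmR : bounded_measurable (fun w : trajectory k =>
    expR (g * discounted b (reward_at pi w) N) * G N (w N)).
  apply: (@observed_bounded_measurable _ _ N); apply: observedM; first exact: oS.
  exact: observed_state.
rewrite -!meanZ//; apply: le_mean; [exact: bounded_measurableZ..|move=> w].
have := GN N (history w N) (ltnSn _); rewrite /bellman tnth_mktuple => hG.
have -> : discounted b (reward_at pi w) N.+1 =
    discounted b (reward_at pi w) N + b ^+ N * reward_at pi w N.
  by rewrite /discounted big_nat_recr.
rewrite mulrDr expRD [g * (b ^+ N * _)]mulrA -mulrA mulrCA.
by rewrite [leRHS]mulrCA ler_wpM2l ?expR_ge0.
Qed.

(** Partial sums converge to the total reward uniformly over trajectories, and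
    the terminal values [G n] tend to [1] uniformly over the finite state space. *)
Lemma mgf_finite_horizon g x pi (G : nat -> 'I_k.+1 -> R) :
  (forall y, G n y @[n --> \oo] --> (1 : R)) ->
  \int[law M x pi]_w (expR (g * discounted b (reward_at pi w) n) * G n (w n))
    @[n --> \oo] --> mgf g x pi.
Proof.
have /andP[b0 b1] := b01.
move=> G1; pose d n : R := \sum_y `|G n y - 1|.
have dn0 : d n @[n --> \oo] --> (0 : R).
  rewrite (_ : 0 = \sum_(y : 'I_k.+1) (0 : R)); last by rewrite big1.
  apply: cvg_big => [|y _]; first exact: add_continuous; rewrite -(normr0 R); apply: cvg_norm.
  by rewrite -(subrr (1 : R)); apply: cvgB; [exact: G1|exact: cvg_cst].
have bn0 : (fun n => `|g| * (b ^+ n * total_bound)) @ \oo --> (0 : R).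
  rewrite -(mulr0 `|g|); apply: cvgMl_tmp; rewrite -(mul0r total_bound); apply: cvgMr_tmp.
  by apply: cvg_expr; rewrite ger0_norm.
pose K := expR (`|g| * total_bound).
have cv : (fun n => K * (d n + `|g| * (b ^+ n * total_bound))) @ \oo --> (0 : R).
  by rewrite -(mulr0 K) -(addr0 (0 : R)); apply: cvgMl_tmp; exact: cvgD.
apply/cvgrPdist_le => e e0; near=> n.
apply: (@le_trans _ _ (K * (d n + `|g| * (b ^+ n * total_bound)))); last first.
  by near: n; exact: (cvgr_le _ cv).
have bp := bounded_measurable_partial_reward pi n.
apply: mean_near.
- exact/bounded_measurable_exp/bounded_measurable_total_reward.
- apply: bounded_measurableM; first exact: bounded_measurable_exp.
  exact: observed_bounded_measurable (observed_state (G n) (leqnn n)).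
move=> w; set S := discounted b _ n; set T := total_reward M b pi w.
have gS : `|g * S| <= `|g| * total_bound.
  by rewrite normrM ler_wpM2l// partial_reward_bound.
have gT : `|g * T| <= `|g| * total_bound.
  by rewrite normrM ler_wpM2l// total_reward_bound.
have -> : expR (g * T) - expR (g * S) * G n (w n) =
    expR (g * S) * (1 - G n (w n)) + (expR (g * T) - expR (g * S)) by ring.
rewrite (le_trans (ler_normD _ _))// [leRHS]mulrDr; apply: lerD.
  rewrite normrM ler_pM//.
    by rewrite ger0_norm ?expR_ge0// ler_expR (le_trans (ler_norm _)).
  by rewrite distrC /d (bigD1 (w n))//= lerDl sumr_ge0.
rewrite (le_trans (expR_lipschitz gT gS))// ler_wpM2l ?expR_ge0//.
by rewrite -mulrBr normrM ler_wpM2l// distrC total_reward_tail.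
Unshelve. all: by end_near. Qed.

(** The terminal condition is [G n --> 1], and not a value at a last stage: the
    risk parameter of stage [n] is [g * b ^+ n], which tends to zero. *)
Lemma verification s g x pi (G : nat -> 'I_k.+1 -> R) :
  (forall n (h : n.+1.-tuple 'I_k.+1),
    s * bellman (g * b ^+ n) (pi n h) (tnth h ord_max) (G n.+1) <=
    s * G n (tnth h ord_max)) ->
  (forall y, G n y @[n --> \oo] --> (1 : R)) ->
  s * mgf g x pi <= s * G 0%N x.
Proof.
move=> Gs G1.
have cv : (fun N => s * \int[law M x pi]_w
    (expR (g * discounted b (reward_at pi w) N) * G N (w N))) @ \oo --> s * mgf g x pi.
  by apply: cvgMl_tmp; exact: mgf_finite_horizon.
apply: (cvgr_to_le cv).
by apply: nearW => N; apply: verification_finite => n h _; exact: Gs.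
Qed.

Lemma mgf_unique g x pi (G : nat -> 'I_k.+1 -> R) :
  (forall n (h : n.+1.-tuple 'I_k.+1),
    bellman (g * b ^+ n) (pi n h) (tnth h ord_max) (G n.+1) = G n (tnth h ord_max)) ->
  (forall y, G n y @[n --> \oo] --> (1 : R)) ->
  mgf g x pi = G 0%N x.
Proof.
move=> GE G1; apply/le_anti/andP; split.
  (* The factors [1] and [-1] give the two inequalities. *)
  by rewrite -[leLHS]mul1r -[leRHS]mul1r; apply: verification => // n h; rewrite GE.
by rewrite -lerN2 -[leLHS]mulN1r -[leRHS]mulN1r; apply: verification => // n h; rewrite GE.
Qed.

Definition stationary (u : stationary_policy k l) : policy k l :=
  policy_of_markov (markov_of_stationary u).

Section stationary_recursion.
Variable u : stationary_policy k l.

(** The finite-horizon value, for which the recursion holds by construction. Its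
    limit is [mgf], which therefore satisfies the recursion too; this replaces a
    shift argument on the path space. *)
Fixpoint horizon_mgf n g x : R :=
  if n is m.+1 then bellman g (u x) x (horizon_mgf m (g * b)) else 1.

Lemma horizon_mgfE n g x :
  \int[law M x (stationary u)]_w
    expR (g * discounted b (reward_at (stationary u) w) n) = horizon_mgf n g x.
Proof.
pose G m y := horizon_mgf (n - m) (g * b ^+ m) y.
have GE m (h : m.+1.-tuple 'I_k.+1) : (m < n)%N ->
    bellman (g * b ^+ m) (stationary u h) (tnth h ord_max) (G m.+1) =
    G m (tnth h ord_max).
  by move=> mn; rewrite /G -(subnSK mn)/= exprSr mulrA.
have -> : \int[law M x (stationary u)]_w
    expR (g * discounted b (reward_at (stationary u) w) n) =
  \int[law M x (stationary u)]_w
    (expR (g * discounted b (reward_at (stationary u) w) n) * G n (w n)).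
  by apply: eq_Rintegral => w _; rewrite /G subnn mulr1.
have -> : horizon_mgf n g x = G 0%N x by rewrite /G subn0 expr0 mulr1.
apply/le_anti/andP; split.
  rewrite -[leLHS]mul1r -[leRHS]mul1r.
  by apply: (@verification_finite _ _ _ _ G n) => // m h mn; rewrite GE.
rewrite -lerN2 -[leLHS]mulN1r -[leRHS]mulN1r.
by apply: (@verification_finite _ _ _ _ G n) => // m h mn; rewrite GE.
Qed.

Lemma horizon_mgf_cvg g x :
  horizon_mgf n g x @[n --> \oo] --> mgf g x (stationary u).
Proof.
have -> : (fun n => horizon_mgf n g x) = (fun n => \int[law M x (stationary u)]_w
    (expR (g * discounted b (reward_at (stationary u) w) n) * 1)).
  by apply/funext => n; rewrite -horizon_mgfE; apply: eq_Rintegral => w _; rewrite mulr1.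
by apply: (@mgf_finite_horizon _ _ _ (fun _ _ => 1)) => y; exact: cvg_cst.
Qed.

Lemma bellman_cvg g a x (G : nat -> 'I_k.+1 -> R) (H : 'I_k.+1 -> R) :
  (forall y, G n y @[n --> \oo] --> H y) ->
  bellman g a x (G n) @[n --> \oo] --> bellman g a x H.
Proof.
by move=> GH; apply: cvgMl_tmp; apply: cvg_big => [|y _]; first exact: add_continuous; apply: cvgMl_tmp; exact: GH.
Qed.

Lemma mgf_stationary g x :
  mgf g x (stationary u) =
  bellman g (u x) x (fun y => mgf (g * b) y (stationary u)).
Proof.
have c1 : (fun n => horizon_mgf n.+1 g x) @ \oo --> mgf g x (stationary u).
  have := @horizon_mgf_cvg g x.
  by rewrite -(cvg_shiftS (fun n => horizon_mgf n g x)).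
rewrite -(cvg_lim (@Rhausdorff R) c1); apply: cvg_lim; first exact: Rhausdorff.
by apply: bellman_cvg => y; exact: horizon_mgf_cvg.
Qed.

Definition deviation (a : 'I_l.+1) : markov_policy k l :=
  fun n => if n is 0%N then fun=> a else u.

(** A one-step update of [mgf] is the [mgf] of a genuine policy, so that it can be
    compared with other policies by [mgf_sign]. *)
Lemma mgf_deviation g a x :
  mgf g x (policy_of_markov (deviation a)) =
  bellman g a x (fun y => mgf (g * b) y (stationary u)).
Proof.
pose G n y := if n is 0%N then bellman g a y (fun y => mgf (g * b) y (stationary u))
  else mgf (g * b ^+ n) y (stationary u).
rewrite (@mgf_unique g x _ G)//.
  move=> [|n] h; rewrite /G/= /policy_of_markov/= ?expr0 ?mulr1//.
  by rewrite [RHS]mgf_stationary -mulrA -exprSr.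
move=> y; rewrite -(cvg_shiftS (fun n => G n y)).
have := mgf_discount_cvg g y (stationary u).
by rewrite -(cvg_shiftS (fun n => mgf (g * b ^+ n) y (stationary u))).
Qed.

End stationary_recursion.

End exponential_functional.

(** * Sign of an analytic function next to a point *)

Section taylor.
Context {R : realType}.

(** The cruder remainder without the factor [1 / N`!] is enough next to zero, and
    it comes from [(N + i)`! >= i`!] alone. *)
Lemma expR_taylor (z : R) N :
  `|expR z - \sum_(0 <= j < N) z ^+ j / j`!%:R| <= `|z| ^+ N * expR `|z|.
Proof.
have cv : (fun m => `|series (exp_coeff z) m - series (exp_coeff z) N|) @ \oo -->
    `|expR z - series (exp_coeff z) N|.
  apply: cvg_norm; apply: cvgB; last exact: cvg_cst.
  exact: is_cvg_series_exp_coeff.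
apply: (cvgr_to_le cv); near=> m.
have Nm : (N <= m)%N by near: m; exact: nbhs_infty_ge.
rewrite /series/= (big_cat_nat (leq0n N) Nm)/= [X in X - _]addrC addrK.
rewrite (le_trans (ler_norm_sum _ _ _))// -{1}[N]add0n big_addn.
apply: (@le_trans _ _ (`|z| ^+ N * \sum_(0 <= i < m - N) exp_coeff `|z| i)).
  rewrite mulr_sumr; apply: ler_sum => i _; rewrite /exp_coeff/= normrM normrX.
  rewrite addnC exprD -mulrA ler_wpM2l ?exprn_ge0// ler_wpM2l ?exprn_ge0//.
  rewrite normfV ger0_norm// lef_pV2 ?posrE ?ltr0n ?fact_gt0// ler_nat.
  by rewrite addnC; exact/leq_fact/leq_addr.
rewrite ler_wpM2l ?exprn_ge0//.
apply: (nondecreasing_cvgn_le (u_ := series (exp_coeff `|z|))).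
  by apply: nondecreasing_series => n _ _; exact: exp_coeff_ge0.
exact: is_cvg_series_exp_coeff.
Unshelve. all: by end_near. Qed.

Variables (K B : R) (D : R -> R) (d : nat -> R).
Hypothesis B0 : 0 <= B.
Hypothesis D_taylor : forall g N,
  `|D g - \sum_(0 <= j < N) g ^+ j * d j| <= K * ((`|g| * B) ^+ N * expR (`|g| * B)).

Let K0 : 0 <= K.
Proof.
have := D_taylor 0 0; rewrite normr0 mul0r expr0 expR0 !mulr1.
exact: le_trans (normr_ge0 _).
Qed.

(** For small [t] the monomial of degree [N] outweighs the remainder of order
    [N.+1]. *)
Lemma taylor_leading (s : R) N : `|s| = 1 ->
  (forall j, (j < N)%N -> d j = 0) -> 0 < s ^+ N.+1 * d N ->
  exists2 e, 0 < e & forall t, 0 < t < e -> 0 < s * D (s * t).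
Proof.
move=> s1 dj c0; set c := _ * d N in c0.
pose L := K * (B ^+ N.+1 * expR B) + 1.
have L0 : 0 < L by rewrite ltr_wpDl// !mulr_ge0 ?exprn_ge0 ?expR_ge0.
exists (Num.min 1 (c / L)); first by rewrite lt_min ltr01 divr_gt0.
move=> t /andP[t0]; rewrite lt_min ltr_pdivlMr// => /andP[t1 tL].
have := D_taylor (s * t) N.+1.
rewrite big_nat_recr//= big_nat big1 ?add0r; last by move=> j /= jN; rewrite dj ?mulr0.
rewrite normrM s1 mul1r (gtr0_norm t0) => h.
have h1 : `|s * D (s * t) - t ^+ N * c| <= t ^+ N * (t * (L - 1)).
  have -> : s * D (s * t) - t ^+ N * c = s * (D (s * t) - (s * t) ^+ N * d N).
    by rewrite /c exprMn exprS; ring.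
  rewrite normrM s1 mul1r (le_trans h)//.
  have -> : t ^+ N * (t * (L - 1)) = K * (t ^+ N.+1 * B ^+ N.+1 * expR B).
    by rewrite /L !exprS; ring.
  rewrite exprMn ler_wpM2l// ler_wpM2l ?mulr_ge0 ?exprn_ge0 ?(ltW t0)//.
  by rewrite ler_expR ler_piMl// ltW.
have : t ^+ N * (t * (L - 1)) < t ^+ N * c.
  by rewrite ltr_pM2l ?exprn_gt0//; lra.
by move: h1; rewrite ler_distl => /andP[h1 _] h2; lra.
Qed.

(** The remainder bounds tend to zero only where [`|g| * B < 1], which is enough
    for a germ. *)
Lemma taylor_flat g : (forall j, d j = 0) -> `|g| * B < 1 -> D g = 0.
Proof.
move=> d0 gB.
have cv : (fun N => K * ((`|g| * B) ^+ N * expR (`|g| * B))) @ \oo --> (0 : R).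
  rewrite -(mulr0 K); apply: cvgMl_tmp; rewrite -(mul0r (expR (`|g| * B))).
  by apply: cvgMr_tmp; apply: cvg_expr; rewrite ger0_norm// mulr_ge0.
apply/normr0_eq0/le_anti; rewrite normr_ge0 andbT.
apply: (cvgr_to_ge cv); apply: nearW => N; have := D_taylor g N.
by rewrite big1 ?subr0// => j _; rewrite d0 mulr0.
Qed.

End taylor.

Section taylor_sign.
Context {R : realType} (K B : R) (D : R -> R) (d : nat -> R).
Hypothesis B0 : 0 <= B.
Hypothesis D_taylor : forall g N,
  `|D g - \sum_(0 <= j < N) g ^+ j * d j| <= K * ((`|g| * B) ^+ N * expR (`|g| * B)).

Lemma taylorN g N : `|- D g - \sum_(0 <= j < N) g ^+ j * - d j| <=
  K * ((`|g| * B) ^+ N * expR (`|g| * B)).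
Proof.
rewrite (eq_bigr (fun j => - (g ^+ j * d j))) => [|j _]; last by rewrite mulrN.
by rewrite sumrN -opprD normrN.
Qed.

(** The sign next to the origin is that of the first nonzero coefficient, or else
    the function vanishes there. *)
Lemma taylor_sign (s : R) : `|s| = 1 -> exists2 e, 0 < e &
  (forall t, 0 < t < e -> 0 <= s * D (s * t)) \/
  (forall t, 0 < t < e -> s * D (s * t) <= 0).
Proof.
move=> s1; have s0 : s != 0 by rewrite -normr_gt0 s1.
have [[n dn]|/forallNP d0] := pselect (exists n, d n != 0); last first.
  exists (B + 1)^-1; first by rewrite invr_gt0 ltr_wpDl.
  left=> t /andP[t0 te]; rewrite (taylor_flat B0 D_taylor) ?mulr0// => [j|].
    by have /negP := d0 j; rewrite negbK => /eqP.
  rewrite normrM s1 mul1r gtr0_norm//.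
  apply: le_lt_trans (_ : t * (B + 1) < 1); first by rewrite ler_wpM2l ?(ltW t0)//; lra.
  by rewrite -ltr_pdivlMr ?div1r // ltr_wpDl.
case: (ex_minnP (ex_intro (fun n => d n != 0) n dn)) => N dN Nmin.
have dj j : (j < N)%N -> d j = 0.
  by move=> jN; apply/eqP; apply: contraTT jN => /Nmin; rewrite -leqNgt.
have [c0|c0|/esym/eqP] := ltgtP 0 (s ^+ N.+1 * d N); last first.
- by rewrite mulf_eq0 expf_eq0/= (negbTE s0) (negbTE dN).
- have [||e e0 he] := @taylor_leading _ K B (fun g => - D g) (fun j => - d j) B0 taylorN s N s1.
  + by move=> j /dj ->; rewrite oppr0.
  + by rewrite mulrN oppr_gt0.
  by exists e => //; right => t /he; rewrite mulrN oppr_gt0 => /ltW.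
- have [e e0 he] := taylor_leading B0 D_taylor s1 dj c0.
  by exists e => //; left => t /he /ltW.
Qed.

End taylor_sign.

(** * Policies that are optimal next to the risk-neutral case *)

Lemma near_at_right0 {R : realType} (P : R -> Prop) :
  (\forall t \near 0^'+, P t) <-> exists2 e, 0 < e & forall t, 0 < t < e -> P t.
Proof.
split=> [[e /= e0 he]|[e e0 he]].
  exists e => // t /andP[t0 te]; apply: he => //=.
  by rewrite sub0r normrN gtr0_norm.
exists e => //= t /=; rewrite sub0r normrN => te t0; apply: he.
by rewrite t0 -(gtr0_norm t0).
Qed.

Section small_risk.
Context {R : realType} {k l : nat} (M : mdp R k l) (b : R).
Hypothesis b01 : 0 < b < 1.
Implicit Types (pi : policy k l) (s t : R).

Let b01' : 0 <= b < 1. Proof. by case/andP: b01 => /ltW -> ->. Qed.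

Local Notation mgf := (mgf M b).
Local Notation mean_reward := (mean_reward M b).
Local Notation bellman := (bellman M).
Local Notation B := (total_bound M b).

Definition moment x pi j : R := \int[law M x pi]_w (total_reward M b pi w) ^+ j.

Lemma mgf_taylor g x pi N :
  `|mgf g x pi - \sum_(0 <= j < N) g ^+ j * (moment x pi j / j`!%:R)| <=
  (`|g| * B) ^+ N * expR (`|g| * B).
Proof.
have bT := bounded_measurable_total_reward M b01' pi.
have bTj j : bounded_measurable (fun w : trajectory k =>
    g ^+ j / j`!%:R * total_reward M b pi w ^+ j).
  exact/bounded_measurableZ/bounded_measurableX.
have -> : \sum_(0 <= j < N) g ^+ j * (moment x pi j / j`!%:R) =
    \int[law M x pi]_w \sum_(0 <= j < N) (g ^+ j / j`!%:R * total_reward M b pi w ^+ j).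
  rewrite mean_sum//; apply: eq_bigr => j _.
  by rewrite meanZ; [rewrite /moment; ring|exact: bounded_measurableX].
apply: mean_near.
- exact: bounded_measurable_exp.
- exact: bounded_measurable_sum.
move=> w; set T := total_reward M b pi w.
have TB : `|g * T| <= `|g| * B by rewrite normrM ler_wpM2l// total_reward_bound.
under eq_bigr do rewrite mulrAC -exprMn.
rewrite (le_trans (expR_taylor _ _))// ler_pM ?exprn_ge0 ?expR_ge0 ?ler_expR//.
by rewrite lerXn2r ?nnegrE// mulr_ge0// (total_bound_ge0 M b01').
Qed.

Lemma mgf_difference_taylor x pi pi' g N :
  `|(mgf g x pi' - mgf g x pi) - \sum_(0 <= j < N)
      g ^+ j * (moment x pi' j / j`!%:R - moment x pi j / j`!%:R)| <=
  2 * ((`|g| * B) ^+ N * expR (`|g| * B)).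
Proof.
under eq_bigr do rewrite mulrBr.
have := mgf_taylor g x pi N; have := mgf_taylor g x pi' N.
rewrite sumrB; set S := \sum_(0 <= j < N) _; set S' := \sum_(0 <= j < N) _ => h h'.
have -> : mgf g x pi' - mgf g x pi - (S - S') =
  (mgf g x pi' - S) - (mgf g x pi - S') by ring.
by rewrite (le_trans (ler_normB _ _))// mulr2n mulrDl mul1r lerD.
Qed.

Lemma mgf_sign s x pi pi' : `|s| = 1 ->
  (\forall t \near 0^'+, s * mgf (s * t) x pi <= s * mgf (s * t) x pi') \/
  (\forall t \near 0^'+, s * mgf (s * t) x pi' <= s * mgf (s * t) x pi).
Proof.
move=> s1.
have [e e0 he] := taylor_sign (total_bound_ge0 M b01') (mgf_difference_taylor x pi pi') s1.
case: he => he; [left|right]; apply/near_at_right0; exists e => // t /he.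
  by rewrite mulrBr subr_ge0.
by rewrite mulrBr subr_le0.
Qed.

Lemma moment0 x pi : moment x pi 0 = 1.
Proof. by rewrite /moment; under eq_Rintegral => w _ do rewrite expr0; rewrite mean_cst. Qed.

Lemma moment1 x pi : moment x pi 1 = mean_reward x pi.
Proof. by rewrite /moment; under eq_Rintegral => w _ do rewrite expr1. Qed.

(** The first-order term of [mgf] is the mean reward, and [s * s = 1]: a
    strict comparison of the means persists for small risk parameters. *)
Lemma le_mean_reward s x pi pi' : `|s| = 1 ->
  (\forall t \near 0^'+, s * mgf (s * t) x pi <= s * mgf (s * t) x pi') ->
  mean_reward x pi <= mean_reward x pi'.
Proof.
move=> s1 /near_at_right0[e e0 he]; rewrite leNgt; apply/negP => lt.
have ss : s ^+ 2 = 1 by rewrite -real_normK ?num_real// s1 expr1n.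
have [||e' e'0 he'] := @taylor_leading _ _ _ _ _ (total_bound_ge0 M b01')
  (mgf_difference_taylor x pi' pi) s 1%N s1.
- by case=> // _; rewrite !moment0 subrr.
- by rewrite ss mul1r !moment1 !divr1 subr_gt0.
pose t := Num.min e e' / 2.
have m0 : 0 < Num.min e e' by rewrite lt_min e0.
have tm : t < Num.min e e' by rewrite /t; lra.
have t0 : 0 < t by rewrite /t; lra.
move: tm; rewrite lt_min => /andP[te te'].
have := he t; have := he' t; rewrite t0 te te' mulrBr subr_gt0 => /(_ isT) h /(_ isT).
by rewrite leNgt h.
Qed.

Let discount_lt e t n : 0 < t < e -> 0 < t * b ^+ n < e.
Proof.
have /andP[b0 b1] := b01; move=> /andP[t0 te].
rewrite mulr_gt0 ?exprn_gt0//=; apply: le_lt_trans te.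
by rewrite ler_piMr ?exprn_ile1 ?ltW.
Qed.

(** Policy improvement: the discounting keeps the risk parameters [s * t * b ^+ n]
    of the later stages in the range where the one-step comparison holds. *)
Lemma policy_improvement s (u v : stationary_policy k l) :
  (forall x, \forall t \near 0^'+, s * mgf (s * t) x (stationary u) <=
     s * bellman (s * t) (v x) x (fun y => mgf (s * t * b) y (stationary u))) ->
  \forall t \near 0^'+, forall x,
    s * mgf (s * t) x (stationary u) <= s * mgf (s * t) x (stationary v).
Proof.
move=> /filter_forall/near_at_right0[e e0 he]; apply/near_at_right0; exists e => // t te x.
have := @verification _ _ _ M b b01' (- s) (s * t) x (stationary v)
  (fun n y => mgf (s * t * b ^+ n) y (stationary u)).
rewrite expr0 mulr1 !mulNr lerN2; apply; last by move=> y; exact: mgf_discount_cvg.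
move=> n h; rewrite !mulNr lerN2 exprSr mulrA.
by have := he _ (discount_lt n te) (tnth h ord_max); rewrite mulrA.
Qed.

(** The converse direction of policy improvement: if no action improves on [u]
    next to zero, then no policy does. *)
Lemma bellman_optimal s (u : stationary_policy k l) :
  (forall x a, \forall t \near 0^'+,
     s * bellman (s * t) a x (fun y => mgf (s * t * b) y (stationary u)) <=
     s * mgf (s * t) x (stationary u)) ->
  \forall t \near 0^'+, forall x pi,
    s * mgf (s * t) x pi <= s * mgf (s * t) x (stationary u).
Proof.
move=> hu; have : \forall t \near 0^'+, forall x a,
     s * bellman (s * t) a x (fun y => mgf (s * t * b) y (stationary u)) <=
     s * mgf (s * t) x (stationary u).
  by apply: filter_forall => x; exact: filter_forall.
move=> /near_at_right0[e e0 he]; apply/near_at_right0; exists e => // t te x pi.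
have := @verification _ _ _ M b b01' s (s * t) x pi
  (fun n y => mgf (s * t * b ^+ n) y (stationary u)).
rewrite expr0 mulr1; apply; last by move=> y; exact: mgf_discount_cvg.
move=> n h; rewrite exprSr mulrA.
by have := he _ (discount_lt n te) (tnth h ord_max) (pi n h); rewrite mulrA.
Qed.

(** Take [u] maximal for the preorder of germs. If an action [a] improved on [u] at
    some state [x], then by [mgf_sign] the policy [v] switching to [a] at [x] would
    be at least as good as [u], hence equivalent to it by maximality; the dynamic
    programming equation of [v] at [x] then says that [a] does not improve on [u]. *)
Lemma exists_small_risk_optimal s : `|s| = 1 ->
  exists u : {ffun 'I_k.+1 -> 'I_l.+1}, \forall t \near 0^'+, forall x pi,
    s * mgf (s * t) x pi <= s * mgf (s * t) x (stationary u).
Proof.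
move=> s1.
pose le_ev (u v : {ffun 'I_k.+1 -> 'I_l.+1}) := \forall t \near 0^'+, forall x,
  s * mgf (s * t) x (stationary u) <= s * mgf (s * t) x (stationary v).
have le_ev_trans (u v w : {ffun 'I_k.+1 -> 'I_l.+1}) : le_ev u v -> le_ev v w -> le_ev u w.
  by move=> uv vw; apply: filterS2 uv vw => t uv vw x; exact: le_trans (uv x) (vw x).
pose below (u : {ffun 'I_k.+1 -> 'I_l.+1}) := [set v | `[< le_ev v u >]]%SET.
have [u umax] : exists u, forall v, le_ev u v -> le_ev v u.
  (* A policy with the most policies below it is maximal, by transitivity. *)
  have [u _ umax] := @arg_maxnP _ [ffun=> ord0] xpredT (fun u => #|below u|) isT.
  exists u => v uv.
  have sub : (below u \subset below v)%SET.
    by apply/fintype.subsetP => w; rewrite !inE => wu; exact: le_ev_trans wu uv.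
  have /eqP e : below u == below v by rewrite eqEcard sub; exact: (umax v isT).
  have : v \in below v by rewrite inE; apply/asboolP; apply: nearW.
  by rewrite -e inE => vu; apply/asboolP.
exists u; apply: bellman_optimal => x a.
have [|h] := mgf_sign x (policy_of_markov (deviation u a)) (stationary u) s1.
  by apply: filterS => t; rewrite mgf_deviation.
pose v := [ffun y => if y == x then a else u y] : {ffun 'I_k.+1 -> 'I_l.+1}.
have uv : le_ev u v.
  apply: policy_improvement => y; rewrite ffunE; case: eqP => [->|_].
    by apply: filterS h => t; rewrite mgf_deviation.
  by apply: nearW => t; rewrite -mgf_stationary.
have /near_at_right0[e e0 he] := umax v uv.
have /near_at_right0[e' e'0 he'] := uv.
have /andP[b0 b1] := b01.
apply/near_at_right0; exists (Num.min e e'); first by rewrite lt_min e0.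
move=> t /andP[t0]; rewrite lt_min => /andP[te te'].
apply: le_trans (he t _ x); last by rewrite t0.
rewrite [in leRHS]mgf_stationary// ffunE eqxx.
rewrite /bellman mulrCA [leRHS]mulrCA ler_wpM2l ?expR_ge0// !mulr_sumr.
apply: ler_sum => y _; rewrite mulrCA [leRHS]mulrCA ler_wpM2l ?trans_ge0//.
rewrite -mulrA; apply: he'; have := @discount_lt e' t 1.
by rewrite expr1; apply; rewrite t0.
Qed.

End small_risk.

(** * Dependence of the criterion on the risk parameter and on the discount *)

Section criterion.
Context {R : realType} {k l : nat} (M : mdp R k l).
Implicit Types (b g s t : R) (pi : policy k l).

Definition dominates b g (u : stationary_policy k l) :=
  forall x pi, J M g x pi b <= J M g x (stationary u) b.

Lemma optimalE b g (u : stationary_policy k l) :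
  optimal M b g (markov_of_stationary u) <-> dominates b g u.
Proof.
split=> [opt x pi|dom x].
  by rewrite -lee_fin (opt x); apply: ereal_sup_ubound; exists pi.
apply/eqP; rewrite eq_le; apply/andP; split.
  by apply: ereal_sup_ubound; exists (stationary u).
by apply: ge_ereal_sup => _ [pi _ <-]; rewrite lee_fin; exact: dom.
Qed.

Lemma J0 b x pi : J M 0 x pi b = mean_reward M b x pi.
Proof. by rewrite /J eqxx fine_expectation. Qed.

Lemma J_mgf b g x pi : g != 0 -> J M g x pi b = g^-1 * ln (mgf M b g x pi).
Proof. by move=> /negPf g0; rewrite /J g0 fine_expectation. Qed.

Lemma mgf_gt0 b g x pi : 0 <= b < 1 -> 0 < mgf M b g x pi.
Proof.
move=> b01; apply: (@lt_le_trans _ _ (expR (- (`|g| * total_bound M b)))).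
  exact: expR_gt0.
rewrite -[leLHS](mean_cst (law M x pi)); apply: le_mean => [||w].
- exact: bounded_measurable_cst.
- exact/bounded_measurable_exp/bounded_measurable_total_reward.
rewrite ler_expR lerNl (le_trans (ler_norm _))// normrN normrM ler_wpM2l//.
exact: total_reward_bound.
Qed.

(** For [s = -1] the factor [(s * t)^-1] of [J] is negative and reverses the order. *)
Lemma le_J b s t x pi pi' : 0 <= b < 1 -> s = 1 \/ s = -1 -> 0 < t ->
  (J M (s * t) x pi b <= J M (s * t) x pi' b) =
  (s * mgf M b (s * t) x pi <= s * mgf M b (s * t) x pi').
Proof.
move=> b01 s1 t0; have st0 : s * t != 0.
  apply: mulf_neq0; last by rewrite gt_eqF.
  by case: s1 => ->; rewrite ?oppr_eq0 oner_eq0.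
rewrite !J_mgf//; have mp p := mgf_gt0 (s * t) x p b01.
case: s1 => sE; rewrite sE in mp *.
  by rewrite !mul1r in mp *; rewrite ler_pM2l ?invr_gt0// ler_ln ?posrE.
by rewrite !mulN1r in mp *; rewrite invrN !mulNr !lerN2 ler_pM2l ?invr_gt0// ler_ln ?posrE.
Qed.

Lemma mgf_continuous b x pi : 0 <= b < 1 -> continuous (fun g => mgf M b g x pi).
Proof.
move=> b01 g; set F := fun g => _.
have lip h : `|h - g| <= 1 -> `|F g - F h| <=
    expR ((`|g| + 1) * total_bound M b) * total_bound M b * `|g - h|.
  move=> hg; apply: mgf_lipschitz => //; first by rewrite lerDl.
  by rewrite -(subrK g h) addrC (le_trans (ler_normD _ _))// lerD2l.
set L := _ * total_bound M b in lip.
have cv : (fun h => L * `|g - h|) @ nbhs g --> (0 : R).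
  rewrite -(mulr0 L); apply: cvgMl_tmp; rewrite -(normr0 R) -(subrr g).
  by apply: cvg_norm; apply: cvgB; [exact: cvg_cst|exact: cvg_id].
apply/cvgrPdist_le => e e0; near=> h.
have hg : `|h - g| <= 1.
  by rewrite distrC ltW//; near: h; exact: near_ball.
apply: le_trans (lip h hg) _.
near: h; exact: (cvgr_le _ cv).
Unshelve. all: by end_near. Qed.

Lemma dominates_left_limit b s t u : 0 <= b < 1 -> s = 1 \/ s = -1 -> 0 < t ->
  (forall t', 0 <= t' < t -> dominates b (s * t') u) -> dominates b (s * t) u.
Proof.
move=> b01 s1 t0 dom x pi; rewrite le_J//.
have cv p : s * mgf M b (s * t') x p @[t' --> t^'-] --> s * mgf M b (s * t) x p.
  apply: cvgMl_tmp; apply: cvg_at_left_filter.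
  apply: (@continuous_comp _ _ _ (fun t' => s * t') (fun g => mgf M b g x p)).
    by apply: cvgMl_tmp; exact: cvg_id.
  exact: mgf_continuous.
apply: (ler_cvg_to (cv pi) (cv (stationary u))); near=> t'.
have t'0 : 0 < t' by near: t'; exact: nbhs_left_gt.
have t't : t' < t by near: t'; exact: nbhs_left_lt.
by rewrite -le_J//; apply: dom; rewrite ltW.
Unshelve. all: by end_near. Qed.

Lemma exists_dominates b s : 0 < b < 1 -> s = 1 \/ s = -1 ->
  exists (u : {ffun 'I_k.+1 -> 'I_l.+1}) (t0 : R), 0 < t0 /\
    forall t, 0 <= t <= t0 -> dominates b (s * t) u.
Proof.
move=> b01 s1.
have b01' : 0 <= b < 1 by case/andP: b01 => /ltW -> ->.
have ns : `|s| = 1 by case: s1 => ->; rewrite ?normrN normr1.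
have [u hu] := exists_small_risk_optimal M b01 ns.
have /near_at_right0[e e0 he] := hu.
exists u, (e / 2); split=> [|t /andP[t0 te] x pi]; first by rewrite divr_gt0.
move: t0; rewrite le_eqVlt => /predU1P[<-|t0].
  rewrite mulr0 !J0; apply: (le_mean_reward b01 ns).
  by apply: filterS hu => t'; exact.
by rewrite le_J//; apply: he; rewrite t0 (le_lt_trans te)//; lra.
Qed.

(** The constant does not depend on the policy nor on the trajectory, so that
    expectations inherit the estimate under every law. *)
Lemma total_reward_lipschitz b b' q pi (w : trajectory k) :
  0 <= b <= q -> 0 <= b' <= q -> q < 1 ->
  `|total_reward M b pi w - total_reward M b' pi w| <=
  reward_bound M / (1 - q) ^+ 2 * `|b - b'|.
Proof.
move=> bq b'q q1; have lt1 c : 0 <= c <= q -> 0 <= c < 1.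
  by move=> /andP[-> /le_lt_trans]; exact.
have cvr c : 0 <= c <= q ->
    discounted c (reward_at M pi w) @ \oo --> total_reward M c pi w.
  by move=> /lt1 c01; exact/is_cvg_discounted/reward_at_bound.
have cv : (fun n => `|discounted b (reward_at M pi w) n - discounted b' (reward_at M pi w) n|) @ \oo
    --> `|total_reward M b pi w - total_reward M b' pi w|.
  by apply: cvg_norm; apply: cvgB; exact: cvr.
apply: (cvgr_to_le cv); apply: nearW => n; rewrite mulrC.
exact/discounted_lipschitz/reward_at_bound.
Qed.

(** The estimates degenerate as the discount factor tends to [1], so they are
    available only below each [q < 1]; the midpoint of [b] and [1] serves as [q]. *)
Lemma continuous_of_locally_lipschitz b (F : R -> R) (L : R -> R) : 0 < b < 1 ->
  (forall q c, q < 1 -> 0 <= b <= q -> 0 <= c <= q -> `|F b - F c| <= L q * `|b - c|) ->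
  {for b, continuous F}.
Proof.
move=> /andP[b0 b1] lip; pose q := (b + 1) / 2.
have q1 : q < 1 by rewrite /q; lra.
have bq : b < q by rewrite /q; lra.
have cv : (fun c => L q * `|b - c|) @ nbhs b --> (0 : R).
  rewrite -(mulr0 (L q)); apply: cvgMl_tmp; rewrite -(normr0 R) -(subrr b).
  by apply: cvg_norm; apply: cvgB; [exact: cvg_cst|exact: cvg_id].
apply/cvgrPdist_le => e e0; near=> c.
have c0 : 0 < c by near: c; exact: lt_nbhsr.
have cq : c < q by near: c; exact: lt_nbhsl.
apply: (@le_trans _ _ (L q * `|b - c|)); first by apply: lip; rewrite ?ltW.
near: c; exact: (cvgr_le _ cv).
Unshelve. all: by end_near. Qed.

Lemma J_continuous_discount b g x pi : 0 < b < 1 ->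
  {for b, continuous (J M g x pi)}.
Proof.
move=> b01; have [->|g0] := eqVneq g 0.
  rewrite (_ : J M 0 x pi = fun c => mean_reward M c x pi); last first.
    by apply/funext => c; exact: J0.
  apply: (continuous_of_locally_lipschitz (L := fun q => reward_bound M / (1 - q) ^+ 2)) => // q c q1 bq cq.
  have lt1 d : 0 <= d <= q -> 0 <= d < 1.
    by move=> /andP[-> /le_lt_trans]; exact.
  apply: mean_near => [||w]; [exact/bounded_measurable_total_reward/lt1..|].
  exact: total_reward_lipschitz.
rewrite (_ : J M g x pi = fun c => g^-1 * ln (mgf M c g x pi)); last first.
  by apply/funext => c; exact: J_mgf.
apply: cvgMl_tmp; apply: (@continuous_comp _ _ _ (fun c => mgf M c g x pi) (@ln R)); last first.
  by apply: continuous_ln; apply: mgf_gt0; case/andP: b01 => /ltW -> ->.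
apply: (continuous_of_locally_lipschitz (L := fun q => expR (`|g| * total_bound M q) *
  (`|g| * (reward_bound M / (1 - q) ^+ 2)))) => // q c q1 bq cq.
have lt1 d : 0 <= d <= q -> 0 <= d < 1.
  by move=> /andP[-> /le_lt_trans]; exact.
have Tq d (w : trajectory k) : 0 <= d <= q ->
    `|g * total_reward M d pi w| <= `|g| * total_bound M q.
  move=> dq; rewrite normrM ler_wpM2l// (le_trans (total_reward_bound _ (lt1 _ dq) _ _))//.
  rewrite /total_bound ler_wpM2l//; first by do 2 (apply: sumr_ge0 => ? _).
  by rewrite lef_pV2 ?posrE; case/andP: dq => *; lra.
apply: mean_near => [||w].
- exact/bounded_measurable_exp/bounded_measurable_total_reward/lt1.
- exact/bounded_measurable_exp/bounded_measurable_total_reward/lt1.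
rewrite (le_trans (expR_lipschitz (Tq _ w bq) (Tq _ w cq)))// -mulrA ler_wpM2l ?expR_ge0//.
by rewrite -mulrBr normrM -mulrA ler_wpM2l// total_reward_lipschitz.
Qed.

Lemma not_dominates_near b g u : 0 < b < 1 -> ~ dominates b g u ->
  \forall c \near b, ~ dominates c g u.
Proof.
move=> b01 /existsNP[x /existsNP[pi /negP]]; rewrite -ltNge -subr_lt0 => lt.
have cv : J M g x (stationary u) c - J M g x pi c @[c --> b] -->
    J M g x (stationary u) b - J M g x pi b.
  by apply: cvgB; exact: J_continuous_discount.
near=> c => /(_ x pi); apply/negP; rewrite -ltNge -subr_lt0; near: c.
exact: (cvgr_lt _ cv).
Unshelve. all: by end_near. Qed.

End criterion.

(** * Thresholds of a closed property of finitely many candidates *)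

Section thresholds.
Context {R : realType} {U : finType} (holds : R -> R -> U -> Prop).

Definition thresholds b : set R :=
  [set t0 | 0 < t0 /\ exists u, forall t, 0 <= t <= t0 -> holds b t u].

Definition threshold b : \bar R := ereal_sup (EFin @` thresholds b).

Hypothesis holds_small : forall b : R, 0 < b < 1 ->
  exists u (t0 : R), 0 < t0 /\ forall t : R, 0 <= t <= t0 -> holds b t u.
Hypothesis holds_closed : forall (b t : R) u, 0 < b < 1 -> 0 < t ->
  (forall t' : R, 0 <= t' < t -> holds b t' u) -> holds b t u.
Hypothesis fails_near : forall (b t : R) u, 0 < b < 1 -> ~ holds b t u ->
  \forall c \near b, ~ holds c t u.

Lemma threshold_gt0 b : 0 < b < 1 -> (0 < threshold b)%E.
Proof.
move=> /holds_small[u [t0 [t0_gt0 hu]]].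
apply: (@lt_le_trans _ _ t0%:E); first by rewrite lte_fin.
by apply: ereal_sup_ubound; exists t0 => //; split=> //; exists u.
Qed.

(** Among finitely many candidates, each failing strictly before the threshold,
    all would have failed by the largest of their failure points; but some
    candidate holds beyond that point. *)
Lemma threshold_attained b : 0 < b < 1 ->
  exists u, forall t, 0 <= t -> (t%:E <= threshold b)%E -> holds b t u.
Proof.
move=> b01; apply: contrapT => /forallNP none.
have fail u : exists t, [/\ 0 <= t, (t%:E < threshold b)%E & ~ holds b t u].
  have /existsNP[t /not_implyP[t0 /not_implyP[tle nt]]] := none u.
  move: t0; rewrite le_eqVlt => /predU1P[t0|t0].
    by exists t; split; rewrite // -t0 ?lexx// threshold_gt0.
  have /existsNP[t' /not_implyP[/andP[t'0 t't] nt']] :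
      ~ forall t', 0 <= t' < t -> holds b t' u by move=> /(holds_closed b01 t0).
  by exists t'; split=> //; rewrite (lt_le_trans _ tle)// lte_fin.
have [f hf] := choice fail.
have [u0 _] := holds_small b01.
have [u _ umax] := @arg_maxP _ _ _ u0 xpredT f isT.
have [_ /ereal_sup_gt[_ [t0 [_ [v hv]] <-]] + _] := hf u; rewrite lte_fin => fut0.
have [fv0 _ nh] := hf v; apply: nh; apply: hv.
by rewrite fv0 (le_trans (umax v isT))// ltW.
Qed.

Lemma threshold_lty b : 0 < b < 1 -> (threshold b < +oo)%E ->
  thresholds b (fine (threshold b)) /\
  forall t0, thresholds b t0 -> t0 <= fine (threshold b).
Proof.
move=> b01 bfin; have bgt0 := threshold_gt0 b01.
have fin : threshold b \is a fin_num by rewrite gt0_fin_numE.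
split=> [|t0 ht0].
  split; first by rewrite -lte_fin fineK.
  have [u hu] := threshold_attained b01; exists u => t /andP[t0 tle].
  by apply: hu => //; rewrite -(fineK fin) lee_fin.
by rewrite -lee_fin fineK//; apply: ereal_sup_ubound; exists t0.
Qed.

(** Every candidate fails somewhere on [[0, a]] and still fails there for
    neighbouring parameters; there are finitely many candidates. *)
Lemma threshold_lt_near b a : 0 < b < 1 -> (threshold b < a%:E)%E ->
  \forall c \near b, 0 < c < 1 -> (threshold c < a%:E)%E.
Proof.
move=> b01 ba.
have a0 : 0 < a by rewrite -lte_fin (lt_trans (threshold_gt0 b01)).
have fail u : exists t, 0 <= t <= a /\ ~ holds b t u.
  apply: contrapT => /forallNP hu; move: ba; rewrite ltNge => /negP; apply.
  apply: ereal_sup_ubound; exists a => //; split=> //; exists u => t ta.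
  by have [//|nt] := pselect (holds b t u); case: (hu t).
have [f hf] := choice fail.
have : \forall c \near b, forall u, ~ holds c (f u) u.
  have near_u u : \forall c \near b, ~ holds c (f u) u.
    by apply: fails_near => //; case: (hf u).
  exact: filter_forall near_u.
apply: filterS => c hc c01; rewrite ltNge; apply/negP => ac.
have [u hu] := threshold_attained c01; apply: (hc u).
have [/andP[fu0 fua] _] := hf u; apply: hu => //.
by rewrite (le_trans _ ac)// lee_fin.
Qed.

End thresholds.

(** Outside of [A] the points of [subspace A] are isolated. *)
Lemma subspace_nbhs {X : topologicalType} (A : set X) (x : X) (Q : X -> Prop) :
  Q x -> (A x -> \forall y \near x, A y -> Q y) ->
  exists2 V, nbhs (x : subspace A) V & forall y, V y -> Q y.
Proof.
move=> Qx QA; exists Q => //.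
by case: _ / (@nbhs_subspaceP _ A x) => [/QA//|_ y ->].
Qed.

(** * The thresholds on both sides of zero *)

Section risk_thresholds.
Context {R : realType} {k l : nat} (M : mdp R k l) (s : R).
Hypothesis s1 : s = 1 \/ s = -1.

Definition risk_holds (b t : R) (u : {ffun 'I_k.+1 -> 'I_l.+1}) := dominates M b (s * t) u.

Lemma risk_holds_closed b t u : 0 < b < 1 -> 0 < t ->
  (forall t', 0 <= t' < t -> risk_holds b t' u) -> risk_holds b t u.
Proof. by case/andP=> b0 b1; apply: dominates_left_limit => //; rewrite ltW. Qed.

Lemma risk_fails_near b t u : 0 < b < 1 -> ~ risk_holds b t u ->
  \forall c \near b, ~ risk_holds c t u.
Proof. exact: not_dominates_near. Qed.

Lemma risk_holds_small b : 0 < b < 1 ->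
  exists u t0, 0 < t0 /\ forall t, 0 <= t <= t0 -> risk_holds b t u.
Proof. by move=> b01; exact: exists_dominates. Qed.

Lemma risk_thresholdsE b : thresholds risk_holds b =
  [set t0 | 0 < t0 /\ exists u : stationary_policy k l,
    forall t, 0 <= t <= t0 -> optimal M b (s * t) (markov_of_stationary u)].
Proof.
apply/seteqP; split=> t0 [t0_gt0 [u hu]]; split=> //.
  by exists u => t /hu /optimalE.
exists (finfun u) => t /hu /optimalE h; rewrite /risk_holds.
by have -> : finfun u = u :> (_ -> _) by apply/funext => x; rewrite ffunE.
Qed.

End risk_thresholds.

Lemma right_thresholdsE (R : realType) k l (M : mdp R k l) b :
  right_thresholds M b = thresholds (risk_holds M 1) b.
Proof.
rewrite risk_thresholdsE; apply/seteqP; split=> t0 [? [u hu]]; split=> //; exists u => t.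
  by rewrite mul1r; exact: hu.
by move=> /hu; rewrite mul1r.
Qed.

Lemma left_thresholdsE (R : realType) k l (M : mdp R k l) b :
  left_thresholds M b = -%R @` thresholds (risk_holds M (-1)) b.
Proof.
rewrite risk_thresholdsE; apply/seteqP; split=> [t0 [t0_lt0 [u hu]]|_ [t0 [t0_gt0 [u hu]] <-]].
  exists (- t0); last by rewrite opprK.
  split; first by rewrite oppr_gt0.
  by exists u => t tt0; apply: hu; rewrite mulN1r oppr_le0 lerNr andbC.
split; first by rewrite oppr_lt0.
exists u => t tt0; rewrite -[t]opprK -mulN1r; apply: hu.
by rewrite oppr_ge0 lerNl andbC.
Qed.

Lemma gamma_rightE (R : realType) k l (M : mdp R k l) :
  gamma_right M = threshold (risk_holds M 1).
Proof. by apply/funext => b; rewrite /gamma_right right_thresholdsE. Qed.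

Lemma gamma_leftE (R : realType) k l (M : mdp R k l) b :
  gamma_left M b = (- threshold (risk_holds M (-1)) b)%E.
Proof.
rewrite /gamma_left /ereal_inf left_thresholdsE !image_comp; congr (- ereal_sup _)%E.
by apply: eq_imagel => t _ /=; rewrite opprK.
Qed.

Theorem corollary4p3 (R : realType) (k l : nat) (M : mdp R k l) :
  [/\ forall beta : R, 0 < beta < 1 ->
        [/\ (gamma_left M beta < 0)%E,
            exists u : stationary_policy k l,
              forall gamma : R, (gamma_left M beta <= gamma%:E)%E -> gamma <= 0 ->
                optimal M beta gamma (markov_of_stationary u)
          & (-oo < gamma_left M beta)%E ->
              left_thresholds M beta (fine (gamma_left M beta)) /\
              forall gamma0 : R, left_thresholds M beta gamma0 ->
                fine (gamma_left M beta) <= gamma0],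
      lower_semicontinuous (gamma_left M : subspace `]0, 1[ -> \bar R),
      forall beta : R, 0 < beta < 1 ->
        [/\ (0 < gamma_right M beta)%E,
            exists u : stationary_policy k l,
              forall gamma : R, 0 <= gamma -> (gamma%:E <= gamma_right M beta)%E ->
                optimal M beta gamma (markov_of_stationary u)
          & (gamma_right M beta < +oo)%E ->
              right_thresholds M beta (fine (gamma_right M beta)) /\
              forall gamma0 : R, right_thresholds M beta gamma0 ->
                gamma0 <= fine (gamma_right M beta)]
    & upper_semicontinuous (gamma_right M : subspace `]0, 1[ -> \bar R)].
Proof.
have small s s1 := @risk_holds_small R k l M s s1.
have closed s s1 := @risk_holds_closed R k l M s s1.
have fails s := @risk_fails_near R k l M s.
have p1 : (1 : R) = 1 \/ (1 : R) = -1 by left.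
have n1 : (-1 : R) = 1 \/ (-1 : R) = -1 by right.
split.
- move=> b b01; rewrite !gamma_leftE; split.
  + by rewrite oppe_lt0; exact: (threshold_gt0 (small _ n1)).
  + have [u hu] := threshold_attained (small _ n1) (closed _ n1) b01.
    exists u => g lg g0; apply/optimalE; rewrite -[g]opprK -mulN1r; apply: hu.
      by rewrite oppr_ge0.
    by rewrite EFinN leeNl.
  + rewrite lteNr => /(threshold_lty (small _ n1) (closed _ n1) b01)[ht le_t].
    rewrite fineN left_thresholdsE; split; first by exists (fine (threshold (risk_holds M (-1)) b)).
    by move=> _ [t /le_t tle <-]; rewrite lerN2.
- move=> b a; rewrite gamma_leftE => ab.
  apply: (@subspace_nbhs _ _ _ (fun c => a%:E < gamma_left M c)%E); first by rewrite gamma_leftE.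
  rewrite /= in_itv/= => b01.
  have : (threshold (risk_holds M (-1)) b < (- a)%:E)%E by rewrite EFinN lteNr.
  move=> /(threshold_lt_near (small _ n1) (closed _ n1) (fails _) b01).
  by apply: filterS => c hc; rewrite in_itv/= => /hc; rewrite gamma_leftE EFinN lteNr.
- move=> b b01; rewrite !gamma_rightE; split.
  + exact: (threshold_gt0 (small _ p1)).
  + have [u hu] := threshold_attained (small _ p1) (closed _ p1) b01.
    exists u => g g0 gl; apply/optimalE; rewrite -[g]mul1r; exact: hu.
  + move=> /(threshold_lty (small _ p1) (closed _ p1) b01)[ht le_t].
    by rewrite right_thresholdsE.
- move=> b a; rewrite gamma_rightE => ab.
  apply: (@subspace_nbhs _ _ _ (fun c => threshold (risk_holds M 1) c < a%:E)%E) => //.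
  rewrite /= in_itv/= => b01.
  have := threshold_lt_near (small _ p1) (closed _ p1) (fails _) b01 ab.
  by apply: filterS => c hc; rewrite in_itv/= => /hc.
Qed.
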